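(* Let $\mathcal{G}$ be a compactly generated minimal groupoid of germs over a Cantor space $X$, with orbital growth function $\beta_{\mathcal{G}}(n)$. Then the group $\mathsf{A}(\mathcal{G})$ has property $\mathrm{FG}_{\beta_{\mathcal{G}}(n)}$ (and the function $\beta_{\mathcal{G}}$ is sharp: $\mathsf{A}(\mathcal{G})$ is a subgroup of $W(\Gamma)$ for a graph $\Gamma$ with $\overline{b}_{\Gamma}\sim\beta_{\mathcal{G}}$, namely for $\Gamma$ any orbital graph of $\mathcal{G}$).
   Context: Pseudogroups and germs. All spaces are Hausdorff; a Cantor space is a space homeomorphic to the Cantor set. A pseudogroup over a compact space $X$ is a collection of homeomorphisms $F\colon U\to V$ between open subsets of $X$ which contains the identity of every open subset of $X$ and is closed under composition (defined on the largest possible domain), inverses, and unions of arbitrary compatible families; a family $\{F_i\colon U_i\to V_i\}$ is compatible if $F_i,F_j$ agree on $U_i\cap U_j$ and $F_i^{-1},F_j^{-1}$ agree on $V_i\cap V_j$ for all $i,j$. The germ $[F]_x$ of $F\colon U\to V$ at $x\in U$ is the class of $(F,x)$, where $(F_1,x_1)\sim(F_2,x_2)$ if $x_1=x_2$ and $F_1,F_2$ coincide near $x_1$. A groupoid of germs over $X$ is the set $\mathcal{G}$ of all germs of elements of some pseudogroup; it determines the pseudogroup, denoted $\widetilde{\mathcal{G}}$. The orbit of $x$ is $\{F(x)\colon F\in\widetilde{\mathcal{G}},\ x\in \mathrm{dom}(F)\}$; $\mathcal{G}$ is minimal if all orbits are dense. $\mathsf{F}(\mathcal{G})$ is the group of elements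 of $\widetilde{\mathcal{G}}$ with domain and range equal to $X$. $\mathsf{A}(\mathcal{G})\le \mathsf{F}(\mathcal{G})$ is the subgroup generated by all 3-cycles, i.e. elements $g\in\mathsf{F}(\mathcal{G})$ of order 3 for which there are disjoint clopen sets $U_1,U_2,U_3$ with $g(U_1)=U_2$, $g(U_2)=U_3$, $g(U_3)=U_1$ and $g$ the identity outside $U_1\cup U_2\cup U_3$. $\mathcal{G}$ (over a Cantor space) is compactly generated if there is a finite set $\mathcal{T}\subset\widetilde{\mathcal{G}}$ of homeomorphisms between clopen subsets of $X$ such that every germ in $\mathcal{G}$ is the germ of a finite product of elements of $\mathcal{T}\cup\mathcal{T}^{-1}$. The orbital graph $\Gamma_x(\mathcal{G},\mathcal{T})$ is the graph whose vertex set is the orbit of $x$, with an edge $(y,T(y))$ for every $T\in\mathcal{T}$ and every $y$ in the orbit in the domain of $T$. Growth. For functions $f,g\colon\mathbb{N}\to\mathbb{N}$, $f\preceq g$ means that there is $C>0$ with $f(n)\le Cg(Cn)$ for all $n$; $f\sim g$ means $f\preceq g\preceq f$. For a discrete metric space $\Gamma$, $\overline{b}_\Gamma(n)=\sup_{v\in\Gamma}|B_\Gamma(v,n)|$, where $B_\Gamma(v,n)$ is the ball of radius $n$; $\Gamma$ is assumed to have bounded geometry, i.e. $\overline{b}_\Gamma(n)<\infty$ for all $n$. The orbital growth of $\mathcal{G}$ is $\beta_{\mathcal{G}}(n)=\max_{x\in X}\overline{b}_{\Gamma_x(\mathcal{G},\mathcal{T})}(n)$; for $\mathcal{G}$ minimal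 it satisfies $\beta_{\mathcal{G}}\sim\overline{b}_{\Gamma_x(\mathcal{G},\mathcal{T})}$ for every $x$, and up to $\sim$ it does not depend on $\mathcal{T}$. Property $\mathrm{FG}_{f(n)}$. The wobbling group $W(\Gamma)$ is the group of permutations $\sigma$ of $\Gamma$ with $\sup_{v}d_\Gamma(v,\sigma(v))<\infty$. For $f\colon\mathbb{N}\to\mathbb{N}$ with $n\preceq f(n)\preceq\exp(n)$, a group $G$ has property $\mathrm{FG}_{f(n)}$ if for every discrete metric space $\Gamma$ (of bounded geometry) such that $f\not\preceq\overline{b}_\Gamma$, every homomorphism $G\to W(\Gamma)$ has finite image. *)

(* Defs.v *)
From HB Require Import structures.
From mathcomp Require Import all_boot all_order all_algebra finmap.
From mathcomp Require Import all_classical all_reals all_analysis.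

Set Implicit Arguments.
Unset Strict Implicit.
Unset Printing Implicit Defensive.

Import Order.TTheory GRing.Theory Num.Theory.

Local Open Scope classical_set_scope.

Definition growth_le (f g : nat -> nat) : Prop :=
  exists2 C : nat, (0 < C)%N & forall n, (f n <= C * g (C * n))%N.

Definition growth_equiv (f g : nat -> nat) : Prop :=
  growth_le f g /\ growth_le g f.

Record sym (T : Type) := Sym {
  sym_fun :> T -> T;
  sym_inv : T -> T;
  sym_funK : cancel sym_fun sym_inv;
  sym_invK : cancel sym_inv sym_fun
}.

HB.instance Definition _ (T : Type) := gen_eqMixin (sym T).
HB.instance Definition _ (T : Type) := gen_choiceMixin (sym T).

Section SymGroup.
Variable T : Type.
Implicit Types s t u : sym T.

Lemma sym_ext s t : s =1 t -> s = t.
Proof.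
case: s t => [f f' fK f'K] [g g' gK g'K] /= /funext fg; subst g.
have e : f' = g'.
  by apply: funext => x; rewrite -[x in RHS]f'K gK.
by subst g'; congr Sym; exact: Prop_irrelevance.
Qed.

Definition sym_one : sym T := @Sym T id id (fun=> erefl) (fun=> erefl).

Definition sym_mul s t : sym T :=
  Sym (can_comp (sym_funK s) (sym_funK t))
      (can_comp (sym_invK t) (sym_invK s)).

Definition sym_V s : sym T := Sym (sym_invK s) (sym_funK s).

Lemma sym_mulA : associative sym_mul.
Proof. by move=> s t u; apply: sym_ext. Qed.
Lemma sym_mul1 : left_id sym_one sym_mul.
Proof. by move=> s; apply: sym_ext. Qed.
Lemma sym_mulr1 : right_id sym_one sym_mul.
Proof. by move=> s; apply: sym_ext. Qed.
Lemma sym_mulV : left_inverse sym_one sym_V sym_mul.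
Proof. by move=> s; apply: sym_ext => x /=; rewrite sym_funK. Qed.
Lemma sym_mulrV : right_inverse sym_one sym_V sym_mul.
Proof. by move=> s; apply: sym_ext => x /=; rewrite sym_invK. Qed.

HB.instance Definition _ := isGroup.Build (sym T)
  sym_mulA sym_mul1 sym_mulr1 sym_mulV sym_mulrV.

End SymGroup.

Lemma sym_mulE (T : Type) (s t : sym T) x : (s * t)%g x = s (t x).
Proof. by []. Qed.

Inductive generated (G : groupType) (S : set G) : set G :=
| generated_mem g : S g -> generated S g
| generated_one : generated S 1%g
| generated_mul g h : generated S g -> generated S h -> generated S (g * h)%g
| generated_inv g : generated S g -> generated S (g^-1)%g.

Section Metric.
Variables (R : realType) (V : metricType R).

Definition cball (v : V) (n : nat) : set V :=
  [set w | (mdist v w <= n%:R)%R].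

(* Finiteness of the balls forces the topology to be discrete. *)
Definition bounded_geometry : Prop :=
  forall n, exists N : nat, forall v,
    finite_set (cball v n) /\ (#|` fset_set (cball v n)| <= N)%N.

(* For spaces of bounded geometry only: otherwise the cardinals and the
   supremum may take default values. *)
Definition growth (n : nat) : nat :=
  supremum 0%N (range (fun v : V => #|` fset_set (cball v n)|)).

Definition wobbling_pred : {pred sym V} :=
  [pred s : sym V | `[< exists C : R, forall v, (mdist v (s v) <= C)%R >]].

Lemma wobbling_group_closed : group_closed wobbling_pred.
Proof.
split; first by apply/asboolP; exists 0%R => v /=; rewrite mdistxx.
move=> s t /asboolP[C sC] /asboolP[D tD]; apply/asboolP; exists (D + C)%R => v.
have -> : (s * t^-1)%g v = s (sym_inv t v) by [].
apply: le_trans (metric_triangle _ (sym_inv t v) _) _.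
apply: lerD; last exact: sC.
by rewrite metric_sym; have := tD (sym_inv t v); rewrite sym_invK.
Qed.

Record wobbling := Wobbling {
  wobbling_val :> sym V;
  _ : wobbling_val \in wobbling_pred
}.

HB.instance Definition _ := [isSub for wobbling_val].
HB.instance Definition _ := [Choice of wobbling by <:].
HB.instance Definition _ := SubChoice_isSubGroup.Build (sym V)
  (mem wobbling_pred) wobbling wobbling_group_closed.

End Metric.

(* [2 ^ n] represents the growth class of the exponential function. *)
Definition property_FG (R : realType) (f : nat -> nat) (G : groupType) : Prop :=
  [/\ growth_le id f, growth_le f (fun n => 2 ^ n)%N &
    forall V : metricType R, bounded_geometry V -> ~ growth_le f (growth V) ->
      forall phi : {multiplicative G -> wobbling V}, finite_set (range phi)].

Section Graph.
Variables (V : choiceType) (E : V -> V -> Prop).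

Fixpoint walk (n : nat) (u v : V) : Prop :=
  if n is m.+1 then exists2 w, E u w \/ E w u & walk m w v else u = v.

Definition connected_graph : Prop := forall u v, exists n, walk n u v.

Definition graph_dist (u v : V) : nat :=
  xget 0%N [set n | walk n u v /\ forall m, walk m u v -> (n <= m)%N].

Lemma walk_cat m n u v w : walk m u v -> walk n v w -> walk (m + n) u w.
Proof.
elim: m u => [|m IH] u /=; first by move=> ->.
by case=> u' uu' u'v vw; exists u' => //; exact: IH.
Qed.

Lemma walk_sym n u v : walk n u v -> walk n v u.
Proof.
elim: n u => [|n IH] u /=; first by move=> ->.
case=> w uw /IH vw; have := @walk_cat n 1 v w u vw; rewrite addn1; apply.
by exists u => //; case: uw; [right|left].
Qed.

Hypothesis conn : connected_graph.

Lemma graph_distP u v :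
  walk (graph_dist u v) u v /\ forall m, walk m u v -> (graph_dist u v <= m)%N.
Proof.
rewrite /graph_dist; case: xgetP => [n _ //|none]; exfalso.
have [n0 n0P] := conn u v.
have ex : exists n, `[< walk n u v >] by exists n0; exact/asboolP.
apply: (none (ex_minn ex)); case: ex_minnP => m /asboolP mP mmin; split=> //.
by move=> k /asboolP; exact: mmin.
Qed.

Lemma graph_distxx u : graph_dist u u = 0%N.
Proof.
by apply/eqP; rewrite -leqn0; have [_] := graph_distP u u; apply.
Qed.

Lemma graph_dist_eq0 u v : graph_dist u v = 0%N -> u = v.
Proof. by move=> e; have [] := graph_distP u v; rewrite e. Qed.

Lemma graph_dist_sym u v : graph_dist u v = graph_dist v u.
Proof.
have [uv uvm] := graph_distP u v; have [vu vum] := graph_distP v u.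
by apply/eqP; rewrite eqn_leq uvm ?vum//; exact: walk_sym.
Qed.

Lemma graph_dist_triangle v u w :
  (graph_dist u w <= graph_dist u v + graph_dist v w)%N.
Proof.
have [_] := graph_distP u w; apply.
have [uv _] := graph_distP u v; have [vw _] := graph_distP v w.
exact: walk_cat uv vw.
Qed.

End Graph.

(* The vertex set of a connected graph with its path metric; edge orientation
   is ignored. *)
Definition graph_space (R : realType) (V : choiceType) (E : V -> V -> Prop)
  (conn : connected_graph E) : Type := V.

Section GraphMetric.
Variables (R : realType) (V : choiceType) (E : V -> V -> Prop).
Variable conn : connected_graph E.
Implicit Types u v w : graph_space R conn.

Definition graph_mdist u v : R := ((graph_dist E u v)%:R)%R.

Let mdist0 u : graph_mdist u u = 0%R.
Proof. by rewrite /graph_mdist (graph_distxx conn). Qed.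

Let mdist_eq0 u v : graph_mdist u v = 0%R -> u = v.
Proof.
move=> /eqP; rewrite /graph_mdist pnatr_eq0 => /eqP; exact: (graph_dist_eq0 conn).
Qed.

Let mdistC u v : graph_mdist u v = graph_mdist v u.
Proof. by rewrite /graph_mdist (graph_dist_sym conn). Qed.

Let mdistD v u w : (graph_mdist u w <= graph_mdist u v + graph_mdist v w)%R.
Proof. by rewrite /graph_mdist -natrD ler_nat (graph_dist_triangle conn). Qed.

HB.instance Definition _ := Choice.copy (graph_space R conn) V.
HB.instance Definition _ := isMetric.Build R (graph_space R conn)
  mdist0 mdist_eq0 mdistC mdistD.

End GraphMetric.

Definition cantor_set_homeomorphic (X : topologicalType) : Prop :=
  exists (f : cantor_space -> X) (g : X -> cantor_space),
    [/\ cancel f g, cancel g f, continuous f & continuous g].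

(* Partial maps are represented by their graphs: [F x y] means that [F] is
   defined at [x] with value [y].  Thus equality of partial maps includes
   equality of domains. *)
Definition partial_map (X : Type) := X -> X -> Prop.

Section PartialMap.
Variable X : Type.
Implicit Types (F H : partial_map X) (U : set X).

Definition pm_dom F : set X := [set x | exists y, F x y].
Definition pm_ran F : set X := [set y | exists x, F x y].
Definition pm_id U : partial_map X := fun x y => U x /\ x = y.
(* first [H], then [F] *)
Definition pm_comp F H : partial_map X := fun x z => exists2 y, H x y & F y z.
Definition pm_inv F : partial_map X := fun x y => F y x.
Definition pm_union (S : set (partial_map X)) : partial_map X :=
  fun x y => exists2 F, S F & F x y.

Definition compatible (S : set (partial_map X)) : Prop :=
  forall F H, S F -> S H ->
    (forall x y z, F x y -> H x z -> y = z) /\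
    (forall x y z, F x z -> H y z -> x = y).

End PartialMap.

Section Germs.
Variable X : topologicalType.
Implicit Types (F H : partial_map X) (x y : X).

(* A homeomorphism between open subsets of X.  As the domain (the preimage of
   setT) and the range are open, continuity of F and of its inverse for the
   subspace topologies can be tested on open subsets of X. *)
Definition partial_homeo F : Prop :=
  [/\ forall x y z, F x y -> F x z -> y = z,
      forall x y z, F x z -> F y z -> x = y,
      forall V, open V -> open [set x | exists2 y, F x y & V y] &
      forall U, open U -> open [set y | exists2 x, F x y & U x]].

Record pseudogroup (P : set (partial_map X)) : Prop := Pseudogroup {
  pseudogroup_homeo : forall F, P F -> partial_homeo F;
  pseudogroup_id : forall U : set X, open U -> P (pm_id U);
  pseudogroup_comp : forall F H, P F -> P H -> P (pm_comp F H);
  pseudogroup_inv : forall F, P F -> P (pm_inv F);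
  pseudogroup_union : forall S, S `<=` P -> compatible S -> P (pm_union S)
}.

(* A germ is an equivalence class of pairs (partial homeomorphism, point). *)
Definition germ F x : set (partial_map X * X) :=
  [set p | [/\ partial_homeo p.1, p.2 = x & \forall z \near x, p.1 z = F z]].

Definition germs_of (P : set (partial_map X)) : set (set (partial_map X * X)) :=
  [set g | exists F x, [/\ P F, pm_dom F x & g = germ F x]].

End Germs.

Record germ_groupoid (X : topologicalType) := GermGroupoid {
  germs : set (set (partial_map X * X));
  germs_pseudogroup : exists2 P, pseudogroup P & germs = germs_of P
}.

Section Groupoid.
Variables (X : topologicalType) (G : germ_groupoid X).
Implicit Types (F H : partial_map X) (x y : X) (T : set (partial_map X)).

(* The pseudogroup determined by a groupoid of germs. *)
Definition groupoid_pseudogroup : set (partial_map X) :=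
  [set F | partial_homeo F /\ forall x, pm_dom F x -> germs G (germ F x)].

Definition groupoid_orbit x : set X :=
  [set y | exists2 F, groupoid_pseudogroup F & F x y].

Definition minimal_groupoid : Prop := forall x, dense (groupoid_orbit x).

Definition full_group : set (sym X) :=
  [set g | groupoid_pseudogroup (fun x y => y = g x)].

Definition three_cycle : set (sym X) :=
  [set g | [/\ full_group g, (g ^+ 3 = 1)%g, g <> 1%g &
    exists U1 U2 U3 : set X,
      [/\ [/\ clopen U1, clopen U2 & clopen U3],
          [/\ U1 `&` U2 = set0, U1 `&` U3 = set0 & U2 `&` U3 = set0],
          [/\ g @` U1 = U2, g @` U2 = U3 & g @` U3 = U1] &
          forall x, ~ (U1 `|` U2 `|` U3) x -> g x = x]]].

Definition alternating_pred : {pred sym X} :=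
  [pred g : sym X | `[< generated three_cycle g >]].

Lemma alternating_group_closed : group_closed alternating_pred.
Proof.
split; first by apply/asboolP; exact: generated_one.
move=> g h /asboolP gA /asboolP hA; apply/asboolP.
by apply: generated_mul => //; exact: generated_inv.
Qed.

(* The group A(G), as a subgroup of the symmetric group of X. *)
Record alternating_full_group := AlternatingFullGroup {
  alternating_full_group_val :> sym X;
  _ : alternating_full_group_val \in alternating_pred
}.

HB.instance Definition _ := [isSub for alternating_full_group_val].
HB.instance Definition _ := [Choice of alternating_full_group by <:].
HB.instance Definition _ := SubChoice_isSubGroup.Build (sym X)
  (mem alternating_pred) alternating_full_group alternating_group_closed.

(* The empty word gives the identity of X. *)
Definition pm_word (s : seq (partial_map X)) : partial_map X :=
  foldr (@pm_comp X) (pm_id setT) s.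

Definition compact_generating T : Prop :=
  [/\ finite_set T, T `<=` groupoid_pseudogroup,
      forall F, T F -> clopen (pm_dom F) /\ clopen (pm_ran F) &
      forall c, germs G c -> exists s x,
        [/\ forall F, F \in s -> T F \/ T (pm_inv F),
            pm_dom (pm_word s) x & c = germ (pm_word s) x]].

Lemma germ_mem F x : partial_homeo F -> germ F x (F, x).
Proof. by split=> //=; exact: nearW. Qed.

(* The pseudogroup is recovered from its germs. *)
Lemma groupoid_pseudogroupE P :
  pseudogroup P -> germs G = germs_of P -> groupoid_pseudogroup = P.
Proof.
move=> PP GP; apply/seteqP; split => F; last first.
  move=> PF; split; first exact: (pseudogroup_homeo PP).
  by move=> x Fx; rewrite GP; exists F, x.
case=> hF gF.
pose S := [set H | P H /\ forall x y, H x y -> F x y].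
have [Ff Fi _ _] := hF.
have -> : F = pm_union S; last first.
  apply: (pseudogroup_union PP) => [H []//|H K [_ HF] [_ KF]]; split.
    by move=> x y z /HF + /KF; exact: Ff.
  by move=> x y z /HF + /KF; exact: Fi.
apply/funext => x; apply/funext => y; apply/propext; split; last first.
  by case=> H [_ HF]; exact: HF.
move=> Fxy.
have : germs_of P (germ F x) by rewrite -GP; apply: gF; exists y.
case=> F' [x' [PF' _ e]].
have := @germ_mem F x hF; rewrite e => -[_ /= xx']; subst x'.
rewrite /prop_near1 nbhsE => -[U [oU Ux] UF].
exists (pm_comp F' (pm_id U)).
  split; last by move=> a b [c [Ua <-]]; rewrite -(UF _ Ua).
  by apply: (pseudogroup_comp PP) => //; exact: (pseudogroup_id PP).
by exists x; [split | rewrite -(UF _ Ux)].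
Qed.

Lemma groupoid_pseudogroupP : pseudogroup groupoid_pseudogroup.
Proof.
have [P PP e] := germs_pseudogroup G.
by rewrite (groupoid_pseudogroupE PP e).
Qed.

Section OrbitalGraph.
Variables (T : set (partial_map X)) (x : X).

Definition orbital_edge (y z : set_type (groupoid_orbit x)) : Prop :=
  exists2 F, T F & F (val y) (val z).

Lemma orbital_connected : compact_generating T -> connected_graph orbital_edge.
Proof.
case=> _ TG _ Tgen.
have PP := groupoid_pseudogroupP.
have words s : (forall F, F \in s -> T F \/ T (pm_inv F)) ->
    forall y z : set_type (groupoid_orbit x), pm_word s (val y) (val z) ->
    walk orbital_edge (size s) z y.
  elim: s => [|F s IH] sT y z /=; first by case=> _ /val_inj.
  case=> c sc Fc.
  have TF : T F \/ T (pm_inv F) by apply: sT; rewrite mem_head.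
  have GF : groupoid_pseudogroup (pm_inv F).
    by case: TF => /TG //; exact: (pseudogroup_inv PP).
  have cO : c \in groupoid_orbit x.
    apply/mem_set; have /set_mem [H GH Hz] := valP z.
    by exists (pm_comp (pm_inv F) H);
      [exact: (pseudogroup_comp PP) | exists (val z)].
  exists (exist _ c cO : set_type (groupoid_orbit x)).
    case: TF => [TF|TF]; [right; by exists F | left; by exists (pm_inv F)].
  by apply: IH => // H Hs; apply: sT; rewrite inE Hs orbT.
move=> y z.
have /set_mem [F GF Fy] := valP y; have /set_mem [H GH Hz] := valP z.
pose K := pm_comp H (pm_inv F).
have [hK gK] : groupoid_pseudogroup K.
  by apply: (pseudogroup_comp PP) => //; exact: (pseudogroup_inv PP).
have Kyz : K (val y) (val z) by exists x.
have [|s [x' [sT _ e]]] := Tgen (germ K (val y)).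
  by apply: gK; exists (val z).
have := @germ_mem K (val y) hK; rewrite e => -[_ /= xx' near_eq]; subst x'.
exists (size s); apply: walk_sym; apply: (words s sT).
by rewrite -(nbhs_singleton near_eq).
Qed.

Definition orbital_graph (R : realType) (hT : compact_generating T) :=
  graph_space R (orbital_connected hT).

End OrbitalGraph.

Definition orbital_growth (R : realType) T (hT : compact_generating T)
    (n : nat) : nat :=
  supremum 0%N (range (fun x : X => growth (orbital_graph x R hT) n)).

End Groupoid.

(* Main.v *)
Require Import Defs.
From HB Require Import structures.
From mathcomp Require Import all_boot all_order all_algebra all_fingroup all_solvable.
From mathcomp Require Import finmap.
From mathcomp Require Import all_classical all_reals all_analysis.

Set Implicit Arguments.
Unset Strict Implicit.
Unset Printing Implicit Defensive.

Import Order.TTheory GRing.Theory Num.Theory.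

(** Write [A] for the alternating full group and [beta] for the orbital growth.

    The heart of the matter is [simultaneously_moved]: if [A] acts nontrivially
    on a set [V], then finitely many elements of [A] that all move one point [x]
    of the Cantor space also move one common point of [V].  Suppose now that
    [A] acts nontrivially on [V] by wobbling permutations.  Every germ of the
    groupoid extends to an element of [A] ([germ_extends_alternating]), so by
    compactness finitely many elements of [A] imitate all generators of the
    groupoid, and a point [y] at distance at most [n] from [x] in its orbital
    graph is [a_y x] for a product [a_y] of at most [n] of these elements or
    their inverses.  The quotients of two distinct [a_y] move [x]; a point [v]
    that they all move has distinct images [a_y v], all within distance [C n]
    of [v].  So [V] has balls of radius [C n] with at least [beta n] points
    ([growth_of_nontrivial_action]); when [V] grows more slowly than [beta], the
    action is therefore trivial.

    For [simultaneously_moved], suppose that each point of [V] is fixed by one of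
    the elements [h_1, ..., h_m], all of which move [x].  Then the stabilizer
    [K] of any point is confined: each [g] in [A] satisfies
    [g^-1 h_i g \in K] for some [i].  Then [K] contains all 3-cycles, hence
    [A], as follows.  Choose many disjoint copies of a small clopen set that
    every [h_i], replaced by a suitable conjugate, pushes off the copies, and
    let the alternating group of the copies act.  Two of its elements [a], [b]
    that conjugate the same [h_i] into [K] give an element of [K] that is
    [a^-1 b] up to a remainder supported off the copies.  By pigeonhole the
    projection of [K] to the alternating group has index at most [m], and as
    there are more copies than that, it is everything ([confined_projection]).
    A second conjugation of the [h_i] gives remainders with another, disjoint
    support; commutators of the two kinds of elements of [K] have no remainder,
    so [K] contains the alternating group of the copies.  Any 3-cycle is a
    product of 3-cycles so small that they arise in this way
    ([confined_contains_three_cycles]).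

    The comparison of growth functions rests on minimality: a ball around any
    point is imitated near every point of a dense orbit ([ball_card_dense]), and
    by compactness each generating set is made of words of bounded length in
    the other ([ball_card_change]).  The same bound shows that [A] wobbles
    every orbital graph; it acts faithfully because orbits are dense. *)

(** * Subgroups of finite alternating groups *)

Section AltFacts.
Local Open Scope group_scope.
Variable I : finType.
Hypothesis I5 : 4 < #|I|.

Lemma normal_Alt_trivial_or_full (N : {group {perm I}}) :
  fingroup.normal N 'Alt_I -> N :!=: 1 -> N :=: 'Alt_I.
Proof.
move=> nN N1; have /simpleP[_ /(_ N nN)[]//] := simple_Alt5 I5.
by move=> e; rewrite e eqxx in N1.
Qed.

(** The 3-cycles are closed under conjugation, so they generate a nontrivial
    normal subgroup of a simple group. *)
Lemma Alt_sub_three_cycles (H : {group {perm I}}) :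
  (forall a b c, uniq [:: a; b; c] -> tperm a b * tperm a c \in H) ->
  'Alt_I \subset H.
Proof.
move=> HC; pose C := [set tperm u.1.1 u.1.2 * tperm u.1.1 u.2 |
  u : I * I * I & uniq [:: u.1.1; u.1.2; u.2]].
have CH : C \subset H.
  apply/fintype.subsetP => _ /finset.imsetP[[[a b] c]] + ->.
  by rewrite inE; apply: HC.
suff <- : <<C>> = 'Alt_I by rewrite gen_subG.
apply: normal_Alt_trivial_or_full.
  rewrite /normal; apply/andP; split.
    rewrite gen_subG; apply/fintype.subsetP => _ /finset.imsetP[[[a b] c]] + ->.
    rewrite inE => u3; rewrite Alt_even odd_permM !odd_tperm.
    by move: u3; rewrite /= !inE negb_or => /andP[/andP[-> ->]].
  apply: (fintype.subset_trans (finset.subsetT _)); apply: norms_gen.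
  apply/fintype.subsetP => s _; rewrite inE.
  apply/fintype.subsetP => _ /finset.imsetP[_ /finset.imsetP[[[a b] c] + ->] ->].
  rewrite inE => u3; apply/finset.imsetP; exists (s a, s b, s c).
    by rewrite inE; move: u3; rewrite /= !inE !(inj_eq perm_inj).
  by rewrite conjMg !tpermJ.
have : uniq (take 3 (enum I)) by rewrite take_uniq ?enum_uniq.
have : size (take 3 (enum I)) = 3 by rewrite size_takel // -cardE (ltn_trans _ I5).
case: (take _ _) => [//|a [//|b [//|c [|//]]]] _ u3.
apply/eqP => C1; have : tperm a b * tperm a c \in <<C>>.
  by apply: mem_gen; apply/finset.imsetP; exists (a, b, c) => //; rewrite inE.
rewrite C1 => /finset.set1P /permP/(_ a); rewrite permM tpermL perm1.
move: u3; rewrite /= !inE negb_or andbT => /andP[/andP[ab ac] bc].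
by rewrite tpermD ?(eq_sym c) // => ba; rewrite ba eqxx in ab.
Qed.

(** A proper subgroup [H] has trivial core by simplicity, so the alternating
    group acts faithfully on the cosets of [H] and its order is at most the
    factorial of the index. *)
Lemma Alt_small_index (H : {group {perm I}}) : H \subset 'Alt_I ->
  2 * (#|'Alt_I : H|)`! < (#|I|)`! -> H :=: 'Alt_I.
Proof.
move=> HA small; set n := #|_ : _| in small.
have nG : fingroup.normal (gcore H 'Alt_I) 'Alt_I.
  by rewrite /normal gcore_norm (fintype.subset_trans (gcore_sub _ _)).
have [core1|/(normal_Alt_trivial_or_full nG) coreA] :=
  eqVneq (gcore H 'Alt_I) 1; last first.
  by apply/eqP; rewrite finset.eqEsubset HA -{1}coreA gcore_sub.
pose S := rcosets H 'Alt_I.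
have faith : [faithful 'Alt_I, on S | 'Rs].
  by rewrite /faithful (astabRs_rcosets H (Alt_group I)) core1 finset.subsetIr.
have AS : actby_cond 'Alt_I S 'Rs by exact: actsRs_rcosets.
have : #|'Alt_I| <= n`!.
  have /isomP[/injmP/card_in_imset + _] := faithful_isom AS faith.
  rewrite -(card_perm S) => <-; apply/subset_leq_card/fintype.subsetP.
  move=> _ /finset.imsetP[g gA ->]; apply/fintype.subsetP => y; rewrite inE.
  apply: contraR => yS; rewrite actpermE /= /actby.
  by rewrite (negPf yS).
by rewrite leqNgt -(@ltn_pmul2l 2)// card_Alt ?small // (ltn_trans _ I5).
Qed.

(** Each [Y i] lies in one left coset of [P], so [P] has index at most [m]. *)
Lemma Alt_full_of_cover m (P : {group {perm I}}) (Y : 'I_m -> {set {perm I}}) :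
  P \subset 'Alt_I -> 2 * m`! < (#|I|)`! ->
  'Alt_I \subset \bigcup_i Y i ->
  (forall i, {in Y i &, forall g h, g^-1 * h \in P}) ->
  P :=: 'Alt_I.
Proof.
move=> PA small cov YP; apply: Alt_small_index => //.
apply: leq_ltn_trans small; rewrite leq_mul2l /=; apply: leq_fact.
rewrite -divgS // leq_divLR ?cardSg //.
have YleP i : #|Y i| <= #|P|.
  have [->|[g gY]] := finset.set_0Vmem (Y i); first by rewrite finset.cards0.
  rewrite -(card_lcoset P g); apply/subset_leq_card/fintype.subsetP => h hY.
  by rewrite mem_lcoset (YP i).
apply: leq_trans (subset_leq_card cov) _.
apply: (@leq_trans (\sum_(i < m) #|Y i|)%N); last first.
  have -> : (m * #|P|)%N = (\sum_(i < m) #|P|)%N by rewrite sum_nat_const card_ord.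
  by apply: leq_sum => i _; exact: YleP.
elim/big_ind2: _ => [|A a B b Aa Bb|//]; first by rewrite finset.cards0.
by apply: leq_trans (leq_card_setU _ _) (leq_add Aa Bb).
Qed.

(** The alternating group is perfect: its derived subgroup is normal, and
    nontrivial since the group is not solvable. *)
Lemma Alt_sub_commutators (H : {group {perm I}}) :
  {in 'Alt_I &, forall g h, [~ g, h] \in H} -> 'Alt_I \subset H.
Proof.
move=> HC; have der : [~: 'Alt_I, 'Alt_I] :=: 'Alt_I.
  apply: normal_Alt_trivial_or_full; first exact: (der_normal 1 (Alt_group I)).
  have := solvable_AltF I5; apply: contraFneq.
  by move/commG1P; exact: (@abelian_sol _ (Alt_group I)).
rewrite -{1}der gen_subG; apply/fintype.subsetP => _ /imset2P[g h gA hA ->].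
exact: HC.
Qed.

End AltFacts.

(** * Topology of the Cantor set *)

Local Open Scope classical_set_scope.

(** Compactness as an induction principle, which turns statements about
    neighbourhoods of single points of [K] into uniform ones. *)
Lemma compact_cover_ind (X : topologicalType) (K : set X) (Q : set X -> Prop) :
  compact K -> Q set0 -> (forall A B, Q A -> Q B -> Q (A `|` B)) ->
  (forall x, K x -> exists U, [/\ open U, U x & Q U]) ->
  exists2 A, K `<=` A & Q A.
Proof.
move=> /compact_near_coveringP cK Q0 QU loc.
pose F := filter_from Q (fun A => [set B | A `<=` B]).
have FF : Filter F.
  apply: filter_from_filter; first by exists set0.
  move=> A B QA QB; exists (A `|` B); first exact: QU.
  by move=> C ABC; split=> x ?; apply: ABC; [left|right].
have [x /loc[U [oU Ux QU']]|A QA /(_ A (@subset_refl _ A)) KA] :=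
  cK _ F (fun B x => B x) FF; last by exists A.
exists (U, [set B | U `<=` B]) => /=.
  by split; [exact: open_nbhs_nbhs | exists U].
by case=> y B /= [Uy]; apply.
Qed.

Lemma finite_closed (X : topologicalType) (s : seq X) :
  hausdorff_space X -> closed [set` s].
Proof.
by move=> /hausdorff_accessible/accessible_finite_set_closed; apply; exact: finite_seq.
Qed.

Section CantorTransport.
Variable X : topologicalType.
Hypothesis hX : cantor_set_homeomorphic X.

Let zero_dimX : zero_dimensional X.
Proof.
move=> x y xy; have [f [g [fK gK cf cg]]] := hX.
have /cantor_zero_dimensional [U [cU Ux Uy]] : g x != g y.
  by apply: contra_neq xy => /(can_inj gK).
by exists (g @^-1` U); split => //; exact: preimage_clopen.
Qed.

Lemma cantor_compact : compact [set: X].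
Proof.
have [f [g [fK gK cf cg]]] := hX.
have -> : [set: X] = f @` [set: cantor_space].
  by apply/esym/seteqP; split=> // x _; exists (g x).
apply: continuous_compact; last exact: cantor_space_compact.
exact: continuous_subspaceT.
Qed.

Lemma cantor_hausdorff : hausdorff_space X.
Proof.
rewrite open_hausdorff => x y /zero_dimX[U [[oU cU] Ux Uy]].
exists (U, ~` U); rewrite /= ?inE //; split=> //; first exact: closed_openC.
by rewrite setICr.
Qed.

Lemma cantor_clopen_base (x : X) (U : set X) : open U -> U x ->
  exists V, [/\ clopen V, V x & V `<=` U].
Proof.
move=> oU Ux.
have /(_ U) [] := @zero_dimensional_cvg X x cantor_hausdorff zero_dimX cantor_compact.
  exact: open_nbhs_nbhs.
by move=> V [Vx cV] VU; exists V.
Qed.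

Lemma cantor_no_isolated (x : X) : ~ open [set x].
Proof.
move=> ox; have [f [g [fK gK cf cg]]] := hX.
have : open [set g x].
  have -> : [set g x] = f @^-1` [set x].
    by apply/seteqP; split=> y /=; [move=> -> | move=> <-]; rewrite ?gK ?fK.
  by move/continuousP: cf; apply.
by move/perfectTP: cantor_perfect; apply.
Qed.

Lemma cantor_nonempty : exists x : X, True.
Proof. by have [f _] := hX; exists (f point). Qed.

End CantorTransport.

(** * The full group *)

Lemma symVK (T : Type) (s : sym T) : cancel s (s^-1)%g.
Proof. exact: sym_funK. Qed.

Lemma symKV (T : Type) (s : sym T) : cancel (s^-1)%g s.
Proof. exact: sym_invK. Qed.

Lemma uniq3P (I : eqType) (a b c : I) :
  uniq [:: a; b; c] -> [/\ a != b, a != c & b != c].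
Proof. by rewrite /= !inE negb_or andbT => /andP[/andP[ab ac] bc]. Qed.

Lemma cycle_permV (I : finType) (a b c : I) : uniq [:: a; b; c] ->
  let p := (tperm a b * tperm a c)%g in
  [/\ (p^-1)%g a = c, (p^-1)%g b = a, (p^-1)%g c = b &
      forall d, d != a -> d != b -> d != c -> (p^-1)%g d = d].
Proof.
move=> /uniq3P[ab ac bc]; split.
- by apply/(canLR (permK _)); rewrite permM (tpermD (z := c)) ?tpermR // 1?eq_sym.
- by apply/(canLR (permK _)); rewrite permM tpermL tpermD // 1?eq_sym.
- by apply/(canLR (permK _)); rewrite permM tpermR tpermL.
move=> d da db dc; apply/(canLR (permK _)).
by rewrite permM !tpermD // eq_sym.
Qed.

Section FullGroup.
Variables (X : topologicalType) (G : germ_groupoid X).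
Let P := groupoid_pseudogroup G.
Let PP : pseudogroup P := groupoid_pseudogroupP G.
Implicit Types (F H : partial_map X) (s t f : sym X) (x y z : X) (V : set X).

(** Membership in the full group is a local condition, because a pseudogroup is
    closed under unions: this allows elements to be assembled piecewise. *)
Lemma full_group_local s :
  (forall x, exists2 F, P F & \forall z \near x, F z (s z)) -> full_group G s.
Proof.
move=> loc; pose S := [set F | P F /\ forall z y, F z y -> y = s z].
rewrite /full_group /=.
have -> : (fun x y => y = s x) = pm_union S.
  apply/funext => x; apply/funext => y; apply/propext.
  split=> [->|[F [_ /(_ x y)]]]; last by apply.
  have [F PF] := loc x; rewrite /prop_near1 nbhsE => -[U [oU Ux] UF].
  exists (pm_comp F (pm_id U)); last by exists x; [split | exact: UF].
  split; first by apply: (pseudogroup_comp PP) => //; exact: (pseudogroup_id PP).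
  have [/(_ _ _ _) Ff _ _ _] := pseudogroup_homeo PP PF.
  by move=> z w [_ [Uz <-] Fzw]; apply: Ff Fzw (UF z Uz).
apply: (pseudogroup_union PP) => [F []//|F H [_ FS] [_ HS]]; split.
  by move=> x y z /FS -> /HS ->.
by move=> x y z /FS -> /HS /(can_inj (sym_funK s)).
Qed.

Lemma full_group1 : full_group G 1%g.
Proof.
apply: full_group_local => x; exists (pm_id setT); last exact: nearW.
exact: (pseudogroup_id PP) openT.
Qed.

Lemma full_groupM s t : full_group G s -> full_group G t -> full_group G (s * t)%g.
Proof.
move=> Ps Pt; change (P (fun x y => y = (s * t)%g x)).
suff <- : pm_comp (fun x y => y = s x) (fun x y => y = t x) =
    (fun x y => y = (s * t)%g x) by exact: (pseudogroup_comp PP).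
apply/funext => x; apply/funext => z; apply/propext.
by split=> [[_ -> ->]|->] //; exists (t x).
Qed.

Lemma full_groupV s : full_group G s -> full_group G (s^-1)%g.
Proof.
move=> Ps; change (P (fun x y => y = (s^-1)%g x)).
suff <- : pm_inv (fun x y => y = s x) = (fun x y => y = (s^-1)%g x).
  exact: (pseudogroup_inv PP).
apply/funext => x; apply/funext => z; apply/propext; rewrite /pm_inv.
by split=> ->; rewrite ?symVK ?symKV.
Qed.

Lemma full_group_continuous s : full_group G s -> continuous s.
Proof.
move=> Ps; apply/continuousP => V oV.
have [_ _ /(_ V oV) + _] := pseudogroup_homeo PP Ps; congr (open _).
by apply/seteqP; split=> [x [_ ->]//|x Vsx]; exists (s x).
Qed.

Lemma full_group_piecewise s :
  (forall x, exists2 f, full_group G f & \forall z \near x, s z = f z) ->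
  full_group G s.
Proof.
move=> loc; apply: full_group_local => x; have [f Pf sf] := loc x.
by exists (fun x y => y = f x).
Qed.

Lemma full_group_clopen s V : full_group G s -> clopen V ->
  clopen [set y | V ((s^-1)%g y)].
Proof.
move=> Ps cV; apply: (@preimage_clopen _ _ (s^-1)%g) => //.
exact/full_group_continuous/full_groupV.
Qed.

(** * Permuting disjoint copies of a set *)

Section Shuffle.
Variables (I : finType) (f : I -> sym X) (V : set X).
Hypothesis disj : forall i j y,
  V (((f i)^-1)%g y) -> V (((f j)^-1)%g y) -> i = j.

Definition copy_index (y : X) : option I :=
  [pick i | `[< V (((f i)^-1)%g y) >]].

Definition shuffle_fun (p : {perm I}) (y : X) : X :=
  if copy_index y is Some i then f ((p^-1)%g i) (((f i)^-1)%g y) else y.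

Lemma mem_copy i x : V x -> V (((f i)^-1)%g (f i x)).
Proof. by rewrite symVK. Qed.

Lemma copy_indexE i y : V (((f i)^-1)%g y) -> copy_index y = Some i.
Proof.
rewrite /copy_index; case: pickP => [j /asboolP Vj Vi|/(_ i)/asboolP//].
by congr Some; exact: disj Vj Vi.
Qed.

Lemma shuffle_funE p i x : V x -> shuffle_fun p (f i x) = f ((p^-1)%g i) x.
Proof. by move=> Vx; rewrite /shuffle_fun (@copy_indexE i) symVK. Qed.

Lemma shuffle_fun_id p y : (forall i, ~ V (((f i)^-1)%g y)) -> shuffle_fun p y = y.
Proof.
move=> nV; rewrite /shuffle_fun /copy_index.
by case: pickP => // i /asboolP /nV.
Qed.

Lemma copy_cases y :
  (exists i x, V x /\ y = f i x) \/ (forall i, ~ V (((f i)^-1)%g y)).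
Proof.
have [[i Vi]|nV] := pselect (exists i, V (((f i)^-1)%g y)).
  by left; exists i, (((f i)^-1)%g y); rewrite symKV.
by right=> i Vi; apply: nV; exists i.
Qed.

Lemma shuffle_funM p q y : shuffle_fun (p * q)%g y = shuffle_fun p (shuffle_fun q y).
Proof.
have [[i [x [Vx ->]]]|nV] := copy_cases y; last by rewrite !shuffle_fun_id.
by rewrite !shuffle_funE // invMg permM.
Qed.

Lemma shuffle_fun1 y : shuffle_fun 1%g y = y.
Proof.
have [[i [x [Vx ->]]]|nV] := copy_cases y; last by rewrite !shuffle_fun_id.
by rewrite shuffle_funE // invg1 perm1.
Qed.

Lemma shuffle_funK p : cancel (shuffle_fun p) (shuffle_fun (p^-1)%g).
Proof. by move=> y; rewrite -shuffle_funM mulVg shuffle_fun1. Qed.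

Lemma shuffle_invK p : cancel (shuffle_fun (p^-1)%g) (shuffle_fun p).
Proof. by move=> y; rewrite -shuffle_funM mulgV shuffle_fun1. Qed.

(** The permutation of [X] that carries the copy [f i @` V] onto the copy with
    index [p^-1 i], by the transition map, and fixes the rest.  With the
    inverse, [shuffle] is a homomorphism: permutations multiply from left to
    right, elements of [sym X] from right to left. *)
Definition shuffle (p : {perm I}) : sym X :=
  Defs.Sym (shuffle_funK p) (shuffle_invK p).

Lemma shuffleE p i x : V x -> shuffle p (f i x) = f ((p^-1)%g i) x.
Proof. exact: shuffle_funE. Qed.

Lemma shuffle_id p y : (forall i, ~ V (((f i)^-1)%g y)) -> shuffle p y = y.
Proof. exact: shuffle_fun_id. Qed.

Lemma shuffle1 : shuffle 1%g = 1%g.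
Proof. by apply: sym_ext => y; exact: shuffle_fun1. Qed.

Lemma shuffleM : {morph shuffle : p q / (p * q)%g}.
Proof. by move=> p q; apply: sym_ext => y; exact: shuffle_funM. Qed.

Lemma shuffleV p : shuffle (p^-1)%g = ((shuffle p)^-1)%g.
Proof. by apply/esym/mulg1_eq; rewrite -shuffleM mulgV shuffle1. Qed.

Hypothesis Pf : forall i, full_group G (f i).
Hypothesis cV : clopen V.

Lemma shuffle_full p : full_group G (shuffle p).
Proof.
have cfV i := full_group_clopen (Pf i) cV.
apply: full_group_piecewise => y; have [[i [x [Vx ->]]]|nV] := copy_cases y.
  exists (f ((p^-1)%g i) * (f i)^-1)%g.
    by apply: full_groupM => //; exact: full_groupV.
  have : nbhs (f i x) [set y | V (((f i)^-1)%g y)].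
    by apply: open_nbhs_nbhs; split; [have [] := cfV i | exact: mem_copy].
  by apply: filterS => z Vz; rewrite -{1}(symKV (f i) z) shuffleE.
exists 1%g; first exact: full_group1.
have : \forall z \near y, forall i, ~ V (((f i)^-1)%g z).
  apply: filter_forall => i; apply: open_nbhs_nbhs; split; last exact: nV.
  by have [_] := cfV i; exact: closed_openC.
by apply: filterS => z nVz; rewrite shuffle_id.
Qed.

Lemma shuffle_three_cycle a b c : V !=set0 -> uniq [:: a; b; c] ->
  three_cycle G (shuffle (tperm a b * tperm a c)%g).
Proof.
move=> [x Vx] abc; have [ab ac bc] := uniq3P abc; set p := (_ * _)%g.
pose copy i := [set y | V (((f i)^-1)%g y)].
have [pVa pVb pVc pVD] := cycle_permV abc.
have copy_im i j : (p^-1)%g i = j -> shuffle p @` copy i = copy j.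
  move=> ij; apply/seteqP; split=> [_ [y Vy <-]|y Vy].
    by rewrite -(symKV (f i) y) shuffleE // ij; exact: mem_copy.
  exists (f i (((f j)^-1)%g y)); first exact: mem_copy.
  by rewrite shuffleE // ij symKV.
have copy_disj i j : i != j -> copy i `&` copy j = set0.
  move=> ij; apply/seteqP; split=> // y [Vi Vj].
  by rewrite (disj Vi Vj) eqxx in ij.
split.
- exact: shuffle_full.
- apply: sym_ext => y; have [[i [z [Vz ->]]]|nV] := copy_cases y; last first.
    by rewrite !expgS expg0 /= !shuffle_fun_id.
  rewrite !expgS expg0 /= !shuffle_funE //.
  have [->|ia] := eqVneq i a; first by rewrite pVa pVc pVb.
  have [->|ib] := eqVneq i b; first by rewrite pVb pVa pVc.
  have [->|ic] := eqVneq i c; first by rewrite pVc pVb pVa.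
  by rewrite !pVD.
- move=> /(congr1 (fun s : sym X => s (f a x))); rewrite shuffleE // pVa /= => e.
  have Va : V (((f a)^-1)%g (f a x)) by exact: mem_copy.
  have Vc : V (((f c)^-1)%g (f a x)) by rewrite -e; exact: mem_copy.
  by rewrite (disj Va Vc) eqxx in ac.
- exists (copy a), (copy c), (copy b); split.
  + by split; exact: full_group_clopen.
  + by split; apply: copy_disj; rewrite // eq_sym.
  + by split; exact: copy_im.
  move=> y out; have [[i [z [Vz yE]]]|nV] := copy_cases y; last first.
    exact: shuffle_id.
  have Vi : copy i y by rewrite yE; exact: mem_copy.
  rewrite yE shuffleE // pVD //; apply/eqP => ie; apply: out; rewrite -ie.
  - by left; left.
  - by right.
  - by left; right.
Qed.

End Shuffle.

End FullGroup.

(** * Germs and finite sets of points under the alternating full group *)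

Section Dynamics.
Variables (X : topologicalType) (G : germ_groupoid X).
Hypotheses (hX : cantor_set_homeomorphic X) (hmin : minimal_groupoid G).
Let P := groupoid_pseudogroup G.
Let PP : pseudogroup P := groupoid_pseudogroupP G.
Local Notation A := (Defs.generated (three_cycle G)).
Implicit Types (F H : partial_map X) (s t f : sym X) (x y z : X).

Lemma alternating_full s : A s -> full_group G s.
Proof.
elim=> [g []//||g h _ Ag _ Ah|g _ Ag].
- exact: full_group1.
- exact: full_groupM.
- exact: full_groupV.
Qed.

Lemma infinite_open (O : set X) (s : seq X) : open O -> O !=set0 ->
  exists2 y, O y & y \notin s.
Proof.
elim: s O => [|a s IH] O oO O0; first by have [y Oy] := O0; exists y.
have o : open (O `&` ~` [set a]).
  apply: openI => //; apply: closed_openC.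
  have := @finite_closed X [:: a] (cantor_hausdorff hX); congr closed.
  by apply/seteqP; split=> y /=; rewrite inE => /eqP.
have [|y [Oy ya] ys] := IH _ o; last first.
  by exists y => //; rewrite inE negb_or ys andbT; apply/eqP.
have [y Oy] := O0; apply: contrapT => none.
apply: (@cantor_no_isolated X hX a); have -> // : [set a] = O.
have eqa z : O z -> z = a.
  by move=> Oz; apply: contrapT => za; apply: none; exists z.
by apply/seteqP; split=> [_ ->|z /eqa//]; rewrite -(eqa y Oy).
Qed.

Lemma orbit_avoid x (O : set X) (s : seq X) : open O -> O !=set0 ->
  exists F y, [/\ P F, F x y, O y & y \notin s].
Proof.
move=> oO O0.
have [y [[Oy ys] [F PF Fxy]]] : (O `&` ~` [set` s]) `&` groupoid_orbit G x !=set0.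
  apply: hmin.
    by have [y Oy /negP ys] := infinite_open s oO O0; exists y.
  by apply: openI => //; apply/closed_openC/finite_closed/cantor_hausdorff.
by exists F, y; split => //; apply/negP.
Qed.

Lemma separate_near z (fs : seq (sym X)) (O : set X) :
  (forall f, f \in fs -> full_group G f) -> nbhs z O ->
  exists V, [/\ clopen V, V z, V `<=` O &
    forall a b, a \in fs -> b \in fs -> a z != b z ->
      forall y y', V y -> V y' -> a y <> b y'].
Proof.
move=> fsF; rewrite nbhsE => -[W [Wo Wz] WO].
suff [U [oU Uz sepU]] : exists U, [/\ open U, U z &
    forall a b, (a, b) \in [seq (a, b) | a <- fs, b <- fs] -> a z != b z ->
      forall y y', U y -> U y' -> a y <> b y'].
  have [V [cV Vz VOU]] := @cantor_clopen_base X hX z _ (openI Wo oU) (conj Wz Uz).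
  exists V; split => // [y /VOU[/WO] //|a b afs bfs ab y y' /VOU[_ Uy] /VOU[_ Uy']].
  by apply: sepU ab _ _ Uy Uy'; apply/allpairsP; exists (a, b).
have : forall ab, ab \in [seq (a, b) | a <- fs, b <- fs] ->
    full_group G ab.1 /\ full_group G ab.2.
  by move=> _ /allpairsP[[a b] [afs bfs ->]] /=; split; exact: fsF.
elim: [seq _ | _ <- _, _ <- _] => [_|[a b] ps IH psF].
  by exists setT; split=> //; exact: openT.
have [|U [oU Uz sepU]] := IH.
  by move=> p pps; apply: psF; rewrite inE pps orbT.
have /= [aF bF] := psF (a, b) (mem_head _ _).
have [abz|abz] := eqVneq (a z) (b z).
  exists U; split=> // a' b'; rewrite inE => /predU1P[[-> ->]|].
    by rewrite abz eqxx.
  exact: sepU.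
have := cantor_hausdorff hX; rewrite open_hausdorff => /(_ _ _ abz).
case=> -[B C] /= [/set_mem Baz /set_mem Cbz] [oB oC /eqP BC].
exists (U `&` (a @^-1` B `&` b @^-1` C)); split=> //.
  apply: openI => //; apply: openI.
    by have /continuousP := full_group_continuous aF; apply.
  by have /continuousP := full_group_continuous bF; apply.
move=> a' b'; rewrite inE => /predU1P[[-> ->] _ y y' [_ [By _]] [_ [_ Cy']] e|].
  suff : (B `&` C) (a y) by rewrite BC.
  by split => //; rewrite e.
by move=> a'b' ne y y' [Uy _] [Uy' _]; exact: sepU a'b' ne _ _ Uy Uy'.
Qed.

(** A germ that moves its base point extends to an involution exchanging a
    small clopen set with its image. *)
Lemma germ_extends_full F x y : P F -> F x y -> x <> y ->
  exists2 s, full_group G s & \forall z \near x, F z (s z).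
Proof.
move=> PF Fxy xy; have [Ff Fi Fo Fo'] := pseudogroup_homeo PP PF.
have t2 := cantor_hausdorff hX.
move/eqP: xy; have := t2; rewrite open_hausdorff => + xy => /(_ _ _ xy).
case=> -[B C] /= [/set_mem Bx /set_mem Cy] [oB oC /eqP BC].
have [V [[oV clV] Vx VBC]] := @cantor_clopen_base X hX x _
  (openI oB (Fo _ oC)) (conj Bx (ex_intro2 _ _ y Fxy Cy)).
pose f z := xget z [set u | F z u]; pose f' z := xget z [set u | F u z].
pose W := [set u | exists2 z, F z u & V z].
have Ff_ z : V z -> F z (f z).
  move=> /VBC[_ [u Fzu _]]; rewrite /f; case: xgetP => [v _ //|/(_ u)].
  by move/(_ Fzu).
have Ff'_ u : W u -> F (f' u) u.
  case=> z Fzu _; rewrite /f'; case: xgetP => [v _ //|/(_ z)].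
  by move/(_ Fzu).
have Wf z : V z -> W (f z) by move=> Vz; exists z => //; exact: Ff_.
have Vf' u : W u -> V (f' u).
  by move=> Wu; have [z Fzu Vz] := Wu; rewrite (Fi _ _ _ (Ff'_ u Wu) Fzu).
have ff' u : W u -> f (f' u) = u.
  by move=> Wu; exact: Ff (Ff_ _ (Vf' _ Wu)) (Ff'_ _ Wu).
have f'f z : V z -> f' (f z) = z.
  by move=> Vz; exact: Fi (Ff'_ _ (Wf _ Vz)) (Ff_ _ Vz).
have VW u : W u -> ~ V u.
  case=> z Fzu Vz Vu; have [_ [u' Fzu' Cu']] := VBC _ Vz.
  have [Bu _] := VBC _ Vu; suff : (B `&` C) u by rewrite BC.
  by split => //; rewrite (Ff _ _ _ Fzu Fzu').
have oW : open W by exact: Fo'.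
have clW : closed W.
  have -> : W = f @` V.
    apply/seteqP; split=> [u Wu|_ [z Vz <-]]; last exact: Wf.
    by exists (f' u); [exact: Vf' | exact: ff'].
  apply: compact_closed => //; apply: continuous_compact; last first.
    exact: subclosed_compact clV (cantor_compact hX) _.
  apply: continuous_in_subspaceT => z /set_mem Vz D; rewrite nbhsE => -[D' [oD' D'z] D'D].
  change (nbhs z (f @^-1` D)).
  apply: (@filterS _ _ _ ([set z' | exists2 u, F z' u & D' u] `&` V)).
    move=> z' [[u Fz'u D'u] Vz'].
    suff : D' (f z') by exact: D'D.
    by rewrite (Ff _ _ _ (Ff_ _ Vz') Fz'u).
  apply: open_nbhs_nbhs; split; first by apply: openI => //; exact: Fo.
  by split => //; exists (f z) => //; exact: Ff_.
pose s z := if `[< V z >] then f z else if `[< W z >] then f' z else z.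
have sV z : V z -> s z = f z by move=> Vz; rewrite /s asboolT.
have sW z : W z -> s z = f' z.
  by move=> Wz; rewrite /s asboolF ?asboolT //; exact: VW.
have sO z : ~ V z -> ~ W z -> s z = z by move=> nV nW; rewrite /s !asboolF.
have sK : cancel s s.
  move=> z; have [Vz|nV] := pselect (V z).
    by rewrite (sV z) // sW ?f'f //; exact: Wf.
  have [Wz|nW] := pselect (W z); last by rewrite !sO.
  by rewrite (sW z) // sV ?ff' //; exact: Vf'.
exists (Defs.Sym sK sK); last first.
  have : nbhs x V by apply: open_nbhs_nbhs.
  by apply: filterS => z Vz /=; rewrite sV //; exact: Ff_.
apply: full_group_local => z; have [Vz|nV] := pselect (V z).
  exists F => //; have : nbhs z V by apply: open_nbhs_nbhs.
  by apply: filterS => u Vu /=; rewrite sV //; exact: Ff_.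
have [Wz|nW] := pselect (W z).
  exists (pm_inv F); first exact: (pseudogroup_inv PP).
  have : nbhs z W by apply: open_nbhs_nbhs.
  by apply: filterS => u Wu /=; rewrite sW //; exact: Ff'_.
exists (pm_id setT); first exact: (pseudogroup_id PP) openT.
have : nbhs z (~` V `&` ~` W).
  by apply: open_nbhs_nbhs; split => //; apply: openI; exact: closed_openC.
by apply: filterS => u [nVu nWu] /=; split=> //; rewrite sO.
Qed.

(** The 3-cycle permutes a small neighbourhood of [x] and its images under [f1]
    and [f2]; the image under [f2] only serves to complete the cycle. *)
Lemma imitate_by_three_cycle x f1 f2 (es : seq X) :
  full_group G f1 -> full_group G f2 ->
  uniq [:: x; f1 x; f2 x] -> {in es, forall e, e \notin [:: x; f1 x; f2 x]} ->
  exists t, [/\ A t, \forall z \near x, t z = f1 z &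
    {in es, forall e, \forall z \near e, t z = z}].
Proof.
move=> F1 F2 u3 esP; pose fs := [:: 1%g; f1; f2].
have fsF f : f \in fs -> full_group G f.
  by rewrite !inE => /or3P[]/eqP-> //; exact: full_group1.
pose f (i : 'I_3) := nth 1%g fs i.
have fF i : full_group G (f i) by apply/fsF/mem_nth.
pose O := ~` [set` es].
have oO : open O by apply/closed_openC/finite_closed/cantor_hausdorff.
pose pts := [:: x; f1 x; f2 x].
have ptsE (i : 'I_3) : nth x pts i = f i x by case: i => [[|[|[|]]]].
have fO i : O (f i x).
  move=> /= /esP /negP; apply; rewrite -ptsE.
  exact: (mem_nth x (ltn_ord i : (i < size pts)%N)).
have [|V [cV Vx VO sepV]] := @separate_near x fs [set z | forall i, O (f i z)] fsF.
  apply: filter_forall => i; apply: open_nbhs_nbhs; split; last exact: fO.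
  by have /continuousP := full_group_continuous (fF i); apply.
have disj i j y : V (((f i)^-1)%g y) -> V (((f j)^-1)%g y) -> i = j.
  move=> Vi Vj; apply: contrapT => /eqP ij.
  apply: (sepV (f i) (f j) _ _ _ _ _ Vi Vj); rewrite ?mem_nth // ?symKV //.
  rewrite -!ptsE (nth_uniq x (ltn_ord i : (i < size pts)%N)
    (ltn_ord j : (j < size pts)%N) u3).
  exact: ij.
(* A shuffle acts by the inverse permutation: this cycle sends copy 0 to copy 1. *)
pose o i : 'I_3 := inord i.
have o3 : uniq [:: o 0; o 2; o 1].
  by rewrite /= !inE -!val_eqE /= !inordK.
exists (shuffle disj (tperm (o 0%N) (o 2%N) * tperm (o 0%N) (o 1%N))%g); split.
- by apply/generated_mem/shuffle_three_cycle => //; exists x.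
- have [p0 _ _ _] := cycle_permV o3.
  have : nbhs x V by apply: open_nbhs_nbhs; split=> //; case: cV.
  apply: filterS => z Vz.
  have -> : z = f (o 0) z by rewrite /f inordK.
  rewrite shuffleE // p0 /f !inordK //.
- move=> e es_e; have : \forall z \near e, forall i, ~ V (((f i)^-1)%g z).
    apply: filter_forall => i; apply: open_nbhs_nbhs.
    have [oV clV] := full_group_clopen (fF i) cV.
    split; first exact: closed_openC.
    move=> Ve; have := VO _ Ve i; rewrite symKV; apply; exact: es_e.
  by apply: filterS => z nV; rewrite shuffle_id.
Qed.

Lemma moving_germ_extends_alternating x F y : P F -> F x y -> x <> y ->
  exists2 t, A t & \forall z \near x, F z (t z).
Proof.
move=> PF Fxy xy; have [f1 F1 f1F] := germ_extends_full PF Fxy xy.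
have [Ff _ _ _] := pseudogroup_homeo PP PF.
have [H [w [PH Hxw _]]] := orbit_avoid x [:: x; y] openT (ex_intro _ x Logic.I).
rewrite !inE negb_or => /andP[/eqP wx /eqP wy].
have [f2 F2 f2H] := germ_extends_full PH Hxw (nesym wx).
have [Hf _ _ _] := pseudogroup_homeo PP PH.
have f1x : f1 x = y by exact: Ff (nbhs_singleton f1F) Fxy.
have f2x : f2 x = w by exact: Hf (nbhs_singleton f2H) Hxw.
have [||t [At tf1 _]] := @imitate_by_three_cycle x f1 f2 [::] F1 F2 _ _ => //.
  rewrite f1x f2x /= !inE negb_or andbT; apply/andP; split.
    by apply/andP; split; apply/eqP => // xw; exact: wx.
  by apply/eqP => yw; exact: wy.
exists t => //; apply: filterS2 f1F tf1 => z Fz tz; rewrite tz; exact: Fz.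
Qed.

(** Every germ of the groupoid is the germ of an element of the alternating
    full group.  A germ that moves its base point is imitated by a 3-cycle;
    any germ factors through a third point of the orbit into two such germs. *)
Lemma germ_extends_alternating x F y : P F -> F x y ->
  exists2 t, A t & \forall z \near x, F z (t z).
Proof.
move=> PF Fxy.
have [H [w [PH Hxw _]]] := orbit_avoid x [:: x; y] openT (ex_intro _ x Logic.I).
rewrite !inE negb_or => /andP[/eqP wx /eqP wy].
have [t1 A1 t1H] := moving_germ_extends_alternating PH Hxw (nesym wx).
have PK : P (pm_comp F (pm_inv H)).
  by apply: (pseudogroup_comp PP) => //; exact: (pseudogroup_inv PP).
have Kwy : pm_comp F (pm_inv H) w y by exists x.
have [t2 A2 t2K] := moving_germ_extends_alternating PK Kwy wy.
exists (t2 * t1)%g; first exact: generated_mul.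
have [Hf Hi _ _] := pseudogroup_homeo PP PH.
have t1x : t1 x = w by exact: Hf (nbhs_singleton t1H) Hxw.
have c1 := full_group_continuous (alternating_full A1).
have t2K' : \forall z \near x, pm_comp F (pm_inv H) (t1 z) (t2 (t1 z)).
  have := c1 x [set u | pm_comp F (pm_inv H) u (t2 u)]; apply.
  by rewrite t1x; exact: t2K.
apply: filterS2 t1H t2K' => z Hz [u Hu Fu]; rewrite sym_mulE.
by rewrite {1}(Hi _ _ _ Hz Hu).
Qed.

Lemma alternating_orbit x (O : set X) (s : seq X) : open O -> O !=set0 ->
  exists t, [/\ A t, O (t x) & t x \notin s].
Proof.
move=> oO O0; have [F [y [PF Fxy Oy ys]]] := orbit_avoid x s oO O0.
have [t At tF] := germ_extends_alternating PF Fxy.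
have [Ff _ _ _] := pseudogroup_homeo PP PF.
by exists t; rewrite -(Ff _ _ _ Fxy (nbhs_singleton tF)).
Qed.

(** The points [ds] are moved one at a time by 3-cycles that fix the points [es]
    and the points already moved. *)
Lemma push_into (ds es : seq X) (O : set X) : open O -> O !=set0 ->
  {in ds, forall d, d \notin es} ->
  exists t, [/\ A t, {in es, forall e, \forall z \near e, t z = z} &
    {in ds, forall d, O (t d)}].
Proof.
move=> oO O0; elim: ds => [_|d ds IH dsP].
  by exists 1%g; split => //; [exact: generated_one | move=> e _; exact: nearW].
have [|t [At tes tds]] := IH.
  by move=> d' d'ds; apply: dsP; rewrite inE d'ds orbT.
have [Otd|nO] := pselect (O (t d)).
  by exists t; split => // d'; rewrite inE => /predU1P[->//|]; exact: tds.
(* [s1] brings [t d] into [O]; [s2] provides the third point of the cycle. *)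
pose bad := t d :: es ++ map t ds.
have [s1 [A1 O1 n1]] := alternating_orbit (t d) bad oO O0.
have [s2 [A2 _ n2]] := alternating_orbit (t d) (s1 (t d) :: bad) oO O0.
have te e : e \in es -> t e = e by move=> /tes /nbhs_singleton.
have n0 : t d \notin es ++ map t ds.
  rewrite mem_cat negb_or; apply/andP; split.
    apply/negP => tdes; have /negP := dsP d (mem_head _ _); apply.
    by rewrite -(can_inj (symVK t) (te _ tdes)) .
  by apply/negP => /mapP[d' /tds + e]; rewrite -e.
have [||u [Au u1 ues]] := @imitate_by_three_cycle (t d) s1 s2 (es ++ map t ds)
  (alternating_full A1) (alternating_full A2).
- move: n1 n2; rewrite /= !inE !negb_or andbT.
  move=> /andP[n1 _] /and3P[n2 n3 _].
  by rewrite eq_sym n1 eq_sym n3 eq_sym n2.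
- move=> e eP; rewrite !inE !negb_or; apply/and3P; split.
  + by apply: contraNneq n0 => <-.
  + by apply: contraNneq n1 => <-; rewrite inE eP orbT.
  + by apply: contraNneq n2 => <-; rewrite !inE eP !orbT.
exists (u * t)%g; split; first exact: generated_mul.
  move=> e ees; have ue : \forall z \near e, u z = z.
    by apply: ues; rewrite mem_cat ees.
  by apply: filterS2 (tes e ees) ue => z tz uz; rewrite sym_mulE tz.
move=> d'; rewrite inE sym_mulE => /predU1P[->|d'ds].
  by rewrite (nbhs_singleton u1).
rewrite (nbhs_singleton (ues (t d') _)); first exact: tds.
by rewrite mem_cat map_f ?orbT.
Qed.

Lemma distinct_images z (fs : seq (sym X)) n :
  exists gs : seq (sym X), [/\ size gs = n, {in gs, forall g, A g} &
    uniq [seq g z | g : sym X <- fs] -> uniq [seq g z | g : sym X <- fs ++ gs]].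
Proof.
elim: n fs => [|n IH] fs; first by exists [::]; rewrite cats0.
have [t [At _ tn]] := alternating_orbit z [seq g z | g : sym X <- fs] openT
  (ex_intro _ z Logic.I).
have [gs [sgs gsA gsu]] := IH (rcons fs t).
exists (t :: gs); split=> /=; first by rewrite sgs.
  by move=> g; rewrite inE => /predU1P[->//|]; exact: gsA.
move=> fsu; rewrite -cat_rcons; apply: gsu.
by rewrite map_rcons rcons_uniq tn.
Qed.

End Dynamics.

(** * Confined subgroups *)

Definition supported (T : Type) (S : set T) (s : sym T) : Prop :=
  forall y, ~ S y -> s y = y.

Lemma supported1 (T : Type) (S : set T) : supported S 1%g.
Proof. by []. Qed.

Lemma supportedM (T : Type) (S : set T) (s t : sym T) :
  supported S s -> supported S t -> supported S (s * t)%g.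
Proof. by move=> sS tS y nS; rewrite sym_mulE tS // sS. Qed.

Lemma supported_stable (T : Type) (S : set T) (s : sym T) y :
  supported S s -> S y -> S (s y).
Proof.
move=> sS Sy; apply: contrapT => nS; apply: (nS).
by have /(can_inj (symVK s)) -> := sS _ nS.
Qed.

Lemma supported_commute (T : Type) (S R : set T) (s r : sym T) :
  S `&` R = set0 -> supported S s -> supported R r -> commute s r.
Proof.
move=> SR sS rR; apply: sym_ext => y; rewrite !sym_mulE.
have SRF z : S z -> R z -> False.
  by move=> Sz Rz; suff : (S `&` R) z by rewrite SR.
have [Sy|nS] := pselect (S y).
  by rewrite !rR //; apply/SRF => //; exact: supported_stable.
have [Ry|nR] := pselect (R y); last by rewrite rR // sS // rR.
rewrite (sS y) // sS // => /SRF; apply; exact: supported_stable.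
Qed.

Lemma commute_commg (gT : groupType) (a b r s : gT) :
  commute a r -> commute b r -> commute a s -> commute b s -> commute r s ->
  [~ a * r, b * s]%g = [~ a, b]%g.
Proof.
move=> ar br as_ bs rs.
have commE (x y : gT) : ([~ x, y] = (y * x)^-1 * (x * y))%g.
  by rewrite commgEl conjgE invMg !mulgA.
have c1 : (a * r * (b * s) = a * b * (r * s))%g.
  by rewrite !mulgA; congr (_ * _)%g; rewrite -!mulgA; congr (_ * _)%g.
have c2 : (b * s * (a * r) = b * a * (r * s))%g.
  rewrite [(r * s)%g]rs !mulgA; congr (_ * _)%g; rewrite -!mulgA; congr (_ * _)%g.
  exact/esym.
have cab : commute (a * b)%g (r * s)%g.
  by apply: commuteM; apply/commute_sym/commuteM; exact/commute_sym.
have cba : commute (b * a)%g (r * s)%g.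
  by apply: commuteM; apply/commute_sym/commuteM; exact/commute_sym.
by rewrite !commE c1 c2 cab cba (invMg (r * s)%g) -mulgA mulKg.
Qed.

Section Confined.
Variables (X : topologicalType) (G : germ_groupoid X).
Hypotheses (hX : cantor_set_homeomorphic X) (hmin : minimal_groupoid G).
Local Notation A := (Defs.generated (three_cycle G)).
Implicit Types (s t f g c : sym X) (x y z : X) (V : set X).

Section Shuffles.
Variables (I : finType) (f : I -> sym X) (V : set X).
Hypothesis disj : forall i j y,
  V (((f i)^-1)%g y) -> V (((f j)^-1)%g y) -> i = j.
Hypotheses (I5 : (4 < #|I|)%N) (Af : forall i, A (f i)).
Hypotheses (cV : clopen V) (V0 : V !=set0).

Definition copies : set X := [set y | exists i, V (((f i)^-1)%g y)].

Lemma shuffle_supported p : supported copies (shuffle disj p).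
Proof. by move=> y nV; apply: shuffle_id => i Vi; apply: nV; exists i. Qed.

Lemma shuffle_alternating p : p \in ('Alt_I)%g -> A (shuffle disj p).
Proof.
pose H : {set {perm I}} := finset (fun p => `[< A (shuffle disj p) >]).
have gH : group_set H.
  apply/group_setP; split.
    by rewrite finset.in_set; apply/asboolP; rewrite shuffle1; exact: generated_one.
  move=> q r; rewrite !finset.in_set => /asboolP Aq /asboolP Ar; apply/asboolP.
  by rewrite shuffleM; exact: generated_mul.
have /fintype.subsetP AH : ('Alt_I)%g \subset Group gH.
  apply: Alt_sub_three_cycles => // a b d abd; rewrite finset.in_set.
  apply/asboolP/generated_mem/shuffle_three_cycle => //.
  by move=> i; exact: alternating_full (Af i).
by move/AH; rewrite finset.in_set => /asboolP.
Qed.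

Variable K : set (sym X).
Hypotheses (K1 : K 1%g) (KM : forall s t, K s -> K t -> K (s * t)%g).
Hypothesis KV : forall s, K s -> K (s^-1)%g.

(** When the conjugates of the same [h i] by [a] and [b] lie in [K], so does
    their quotient, which is [a^-1 * b] up to a factor supported in [W]: this
    factor is conjugate by [h i] to an element supported on the copies.  Hence
    the elements of the alternating group that conjugate [h i] into [K] lie in
    one coset of the projection of [K], and these cosets cover the group. *)
Lemma confined_projection m (h : 'I_m -> sym X) (W : set X) :
  (2 * m`! < (#|I|)`!)%N ->
  (forall i j x, V x -> W (h i (f j x))) ->
  copies `&` W = set0 ->
  (forall g, A g -> exists i, K (g^-1 * h i * g)%g) ->
  forall q, q \in ('Alt_I)%g ->
    exists2 r, supported W r & K (shuffle disj q * r)%g.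
Proof.
move=> small hW VW conf.
pose Q : {set {perm I}} := finset (fun q => (q \in ('Alt_I)%g) &&
  `[< exists2 r, supported W r & K (shuffle disj q * r)%g >]).
have QP q : reflect (q \in ('Alt_I)%g /\
    exists2 r, supported W r & K (shuffle disj q * r)%g) (q \in Q).
  rewrite [q \in Q]finset.in_set.
  by apply: (iffP idP) => [/andP[qA /asboolP]|[qA ?]]; rewrite ?qA //; exact/asboolP.
have gQ : group_set Q.
  apply/group_setP; split.
    apply/QP; split; first exact: group1.
    by exists 1%g; rewrite ?shuffle1 ?mulg1 //; exact: supported1.
  move=> q q' /QP[qA [r rW Kr]] /QP[q'A [r' r'W Kr']].
  apply/QP; split; first exact: groupM.
  exists (r * r')%g; first exact: supportedM.
  have <- : (shuffle disj q * r * (shuffle disj q' * r'))%g =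
    (shuffle disj (q * q') * (r * r'))%g; last exact: KM.
  rewrite shuffleM -!mulgA; congr (_ * _)%g; rewrite !mulgA; congr (_ * _)%g.
  exact/esym/(supported_commute VW)/rW/shuffle_supported.
pose Y i : {set {perm I}} := finset (fun q =>
  `[< K ((shuffle disj q)^-1 * h i * shuffle disj q)%g >]).
have YP i q : reflect (K ((shuffle disj q)^-1 * h i * shuffle disj q)%g) (q \in Y i).
  by rewrite [q \in Y i]finset.in_set; exact: asboolP.
suff QA : Group gQ = ('Alt_I)%g :> {set {perm I}}.
  by move=> q; rewrite -QA => /QP[].
apply: (@Alt_full_of_cover _ I5 m _ (fun i => Y i :&: 'Alt_I)%g) => //.
- by apply/fintype.subsetP => q /QP[].
- apply/fintype.subsetP => q qA; have [i Ki] := conf _ (shuffle_alternating qA).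
  by apply/finset.bigcupP; exists i => //; apply/finset.setIP; split=> //; exact/YP.
move=> i q q' /finset.setIP[/YP Kq qA] /finset.setIP[/YP Kq' q'A].
apply/QP; split; first by apply: groupM => //; rewrite groupV.
set a := shuffle disj q in Kq; set b := shuffle disj q' in Kq'.
have rW : supported W (h i * (a * b^-1) * (h i)^-1)%g.
  move=> y nW; rewrite !sym_mulE.
  have nV : ~ copies (((h i)^-1)%g y).
    case=> j /(hW i j); rewrite !symKV; exact: nW.
  have sab : supported copies (a * b^-1)%g.
    by rewrite /b -shuffleV; apply: supportedM; exact: shuffle_supported.
  by have := sab _ nV; rewrite sym_mulE => ->; rewrite symKV.
exists (h i * (a * b^-1) * (h i)^-1)%g => //.
have -> : (shuffle disj (q^-1 * q') * (h i * (a * b^-1) * (h i)^-1))%g =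
   (a^-1 * h i * a * (b^-1 * h i * b)^-1)%g; last exact/KM/KV.
have br := supported_commute VW (@shuffle_supported q') rW; rewrite -/b in br.
by rewrite shuffleM shuffleV -/a -/b -mulgA br !invMg invgK -!mulgA.
Qed.

(** The commutator of two elements with disjoint remainders has no remainder, so
    two projections off disjoint sets put all commutators, hence the whole
    alternating group of the copies, into [K]. *)
Lemma alternating_of_projections (W1 W2 : set X) :
  copies `&` W1 = set0 -> copies `&` W2 = set0 -> W1 `&` W2 = set0 ->
  (forall q, q \in ('Alt_I)%g ->
    exists2 r, supported W1 r & K (shuffle disj q * r)%g) ->
  (forall q, q \in ('Alt_I)%g ->
    exists2 r, supported W2 r & K (shuffle disj q * r)%g) ->
  forall q, q \in ('Alt_I)%g -> K (shuffle disj q).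
Proof.
move=> d1 d2 d12 proj1 proj2 q.
pose Q : {set {perm I}} := finset (fun q => `[< K (shuffle disj q) >]).
have QP p : reflect (K (shuffle disj p)) (p \in Q).
  by rewrite [p \in Q]finset.in_set; exact: asboolP.
have gQ : group_set Q.
  apply/group_setP; split; first by apply/QP; rewrite shuffle1.
  by move=> p p' /QP Kp /QP Kp'; apply/QP; rewrite shuffleM; exact: KM.
have /fintype.subsetP AQ : ('Alt_I)%g \subset Group gQ.
  apply: Alt_sub_commutators => // p p' /proj1[r rW Kr] /proj2[r' r'W Kr'].
  apply/QP; rewrite commgEl conjgE !shuffleM !shuffleV -conjgE -commgEl.
  rewrite -(@commute_commg _ _ _ r r').
  - rewrite commgEl conjgE; apply: (KM (KV Kr)).
    by apply: (KM (KV Kr')); exact: KM.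
  - exact: supported_commute d1 (@shuffle_supported p) rW.
  - exact: supported_commute d1 (@shuffle_supported p') rW.
  - exact: supported_commute d2 (@shuffle_supported p) r'W.
  - exact: supported_commute d2 (@shuffle_supported p') r'W.
  - exact: supported_commute d12 rW r'W.
by move=> qA; apply/QP/AQ.
Qed.

End Shuffles.
End Confined.

(** * Restricting 3-cycles *)

Section Restriction.
Variables (X : Type) (c : sym X).
Hypothesis c3 : (c ^+ 3 = 1)%g.
Implicit Types (V : set X) (s : sym X) (y : X).

(** The union of the images of [V] under the powers of [c], which has order 3. *)
Definition spread V : set X :=
  [set y | [\/ V y, V ((c^-1)%g y) | V ((c^-1)%g ((c^-1)%g y))]].

Definition restricts V s : Prop :=
  (forall y, spread V y -> s y = c y) /\ supported (spread V) s.

Lemma cube_id y : c (c (c y)) = y.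
Proof. by have := congr1 (fun s : sym X => s y) c3. Qed.

Lemma cubeV y : (c^-1)%g ((c^-1)%g y) = c y.
Proof. by rewrite -{1}(cube_id y) !symVK. Qed.

Lemma spreadE V y : spread V y <-> [\/ V y, V ((c^-1)%g y) | V (c y)].
Proof. by rewrite -(cubeV y). Qed.

Lemma spread_stable V y : spread V (c y) <-> spread V y.
Proof.
have cc : c (c y) = (c^-1)%g y by apply: (can_inj (symVK c)); rewrite cube_id symKV.
rewrite !spreadE symVK cc; split=> -[] ?;
  by [constructor 1|constructor 2|constructor 3].
Qed.

Lemma spread_stableV V y : spread V ((c^-1)%g y) <-> spread V y.
Proof. by rewrite -spread_stable symKV. Qed.

Lemma exists_restriction V : exists s, restricts V s.
Proof.
pose s y := if `[< spread V y >] then c y else y.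
pose s' y := if `[< spread V y >] then (c^-1)%g y else y.
have sT y : spread V y -> s y = c y by move=> Sy; rewrite /s asboolT.
have sF y : ~ spread V y -> s y = y by move=> nS; rewrite /s asboolF.
have s'T y : spread V y -> s' y = (c^-1)%g y by move=> Sy; rewrite /s' asboolT.
have s'F y : ~ spread V y -> s' y = y by move=> nS; rewrite /s' asboolF.
have sK : cancel s s'.
  move=> y; have [Sy|nS] := pselect (spread V y); last by rewrite sF // s'F.
  by rewrite sT // s'T ?symVK //; exact/spread_stable.
have s'K : cancel s' s.
  move=> y; have [Sy|nS] := pselect (spread V y); last by rewrite s'F // sF.
  by rewrite s'T // sT ?symKV //; exact/spread_stableV.
exists (Defs.Sym sK s'K); split=> y; [exact: sT | exact: sF].
Qed.

Lemma restricts_ext V s t : restricts V s -> restricts V t -> s = t.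
Proof.
move=> [sc sS] [tc tS]; apply: sym_ext => y.
have [Sy|nS] := pselect (spread V y); first by rewrite sc // tc.
by rewrite sS // tS.
Qed.

End Restriction.

(** With the copies indexed by [i0], [i1], [i2] placed at [V] and its images under
    [c] and [c ^ 2], the restriction of [c] is the shuffle by a 3-cycle; the
    other copies are left in place. *)
Lemma shuffle_restricts (X : topologicalType) (I : finType) (f : I -> sym X)
    (V : set X)
    (disj : forall i j y, V (((f i)^-1)%g y) -> V (((f j)^-1)%g y) -> i = j)
    (c : sym X) (i0 i1 i2 : I) :
  (c ^+ 3 = 1)%g -> f i0 = 1%g -> f i1 = c -> f i2 = (c * c)%g ->
  uniq [:: i0; i2; i1] ->
  restricts c V (shuffle disj (tperm i0 i2 * tperm i0 i1)%g).
Proof.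
move=> c3 f0 f1 f2 u012; have [p0 p2 p1 pD] := cycle_permV u012.
split=> [y|y nS].
  case=> Vy.
  - have {1}-> : y = f i0 y by rewrite f0.
    by rewrite shuffleE // p0 f1.
  - have {1}-> : y = f i1 ((c^-1)%g y) by rewrite f1 symKV.
    by rewrite shuffleE // p1 f2 sym_mulE symKV.
  - have {1}-> : y = f i2 ((c^-1)%g ((c^-1)%g y)) by rewrite f2 sym_mulE !symKV.
    by rewrite shuffleE // p2 f0; exact: (cubeV c3).
have [[i [w [Vw e]]]|nV] := copy_cases f V y; last exact: shuffle_id.
have ne j : spread c V (f j w) -> i != j.
  by move=> S; apply: contra_notN nS => /eqP ij; rewrite e ij.
rewrite e shuffleE // pD //; apply: ne.
- by constructor 1; rewrite f0.
- by constructor 3; rewrite f2 sym_mulE !symVK.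
- by constructor 2; rewrite f1 symVK.
Qed.

(** * Confined subgroups contain all 3-cycles *)

Section ConfinedTheorem.
Variables (X : topologicalType) (G : germ_groupoid X).
Hypotheses (hX : cantor_set_homeomorphic X) (hmin : minimal_groupoid G).
Local Notation A := (Defs.generated (three_cycle G)).
Implicit Types (s t f g c : sym X) (x y z : X) (V : set X).

Variable K : set (sym X).
Hypotheses (K1 : K 1%g) (KM : forall s t, K s -> K t -> K (s * t)%g).
Hypothesis KV : forall s, K s -> K (s^-1)%g.

Variables (m : nat) (h : 'I_m -> sym X) (x : X).
Hypotheses (hA : forall i, A (h i)) (hx : forall i, h i x <> x).
Hypothesis conf : forall g, A g -> exists i, K (g^-1 * h i * g)%g.

Lemma conjugate_confined t : A t ->
  forall g, A g -> exists i, K (g^-1 * (t^-1 * h i * t) * g)%g.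
Proof.
move=> At g Ag; have [i Ki] := conf (generated_mul At Ag); exists i.
by move: Ki; rewrite invMg !mulgA.
Qed.

(** The first three of [m + 5] copies of a small [V] are [V] and its images under
    [c] and [c ^ 2], so the restriction of [c] to the spread of [V] is an even
    permutation of the copies.  With [m + 5] copies the alternating group is
    simple and [2 * m! < (m + 5)!], as the projection argument demands. *)
Lemma confined_contains_small_cycles c z : A c -> (c ^+ 3 = 1)%g ->
  uniq [:: z; c z; c (c z)] ->
  exists U, [/\ clopen U, U z &
    forall V s, clopen V -> V `<=` U -> restricts c V s -> K s].
Proof.
move=> Ac c3 zu.
pose fs0 := [:: 1%g; c; (c * c)%g].
have [gs [gs_size gsA fsu]] := distinct_images hX hmin z fs0 m.+2.
pose fs := fs0 ++ gs.
have fs_size : size fs = (m + 5)%N by rewrite size_cat gs_size /= addnC -addn2 -addnA.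
have fsA : {in fs, forall f, A f}.
  move=> f; rewrite mem_cat => /orP[|/gsA//].
  rewrite !inE => /or3P[]/eqP->.
  - exact: generated_one.
  - exact: Ac.
  - exact: generated_mul.
pose f (j : 'I_(m + 5)) := nth 1%g fs j.
have jfs (j : 'I_(m + 5)) : (j < size fs)%N by rewrite fs_size.
have ffs j : f j \in fs by exact: mem_nth.
have fA j : A (f j) by exact/fsA/ffs.
have f_inj i j : f i z = f j z -> i = j.
  move=> e; apply/ord_inj/eqP.
  rewrite -(nth_uniq z (_ : (i < size [seq g z | g : sym X <- fs])%N) _ (fsu zu))
    ?size_map ?jfs //.
  by rewrite !(nth_map 1%g) //; apply/eqP; exact: e.
have full g : A g -> full_group G g by exact: alternating_full.
(* The points [f j z] are carried to a neighbourhood of [x] that every [h i]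
   moves off itself, so that the conjugates [k i] push them off each other. *)
have hF g : g \in 1%g :: codom h -> full_group G g.
  rewrite inE => /predU1P[->|/codomP[i ->]]; first exact: full_group1.
  exact/full/hA.
have xT : nbhs x setT by exact: filterT.
have [U [cU Ux _ Usep]] := separate_near hX hF xT.
have hU i y y' : U y -> U y' -> h i y <> y'.
  move=> Uy Uy'; have /= := Usep (h i) 1%g _ _ _ y y' Uy Uy'; apply.
  - by rewrite inE codom_f orbT.
  - by rewrite inE eqxx.
  - exact/eqP/hx.
pose pts := [seq g z | g : sym X <- fs].
have f_pts j : f j z \in pts by exact: (map_f (fun g : sym X => g z)).
have [||//|t [At _ tU]] := @push_into _ _ hX hmin pts [::] U.
- by case: cU.
- by exists x.
pose k i := (t^-1 * h i * t)%g.
have kA i : A (k i).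
  by apply: generated_mul => //; apply: generated_mul => //; exact: generated_inv.
have k_off i j l : k i (f j z) <> f l z.
  rewrite /k !sym_mulE => /(congr1 t); rewrite symKV.
  by apply: hU; apply: tU.
(* Conjugating further by an element that fixes the points [f j z] but moves
   the points [k i (f j z)] off themselves gives the second family. *)
pose img (u : 'I_m * 'I_(m + 5)) := k u.1 (f u.2 z).
pose imgs := codom img.
have in_imgs i j : k i (f j z) \in imgs by exact: (codom_f img (i, j)).
have [|||t2 [At2 t2_id t2_off]] := @push_into _ _ hX hmin imgs pts (~` [set` imgs]).
- exact/closed_openC/finite_closed/(cantor_hausdorff hX).
- have [y _ /negP yn] := infinite_open hX imgs openT (ex_intro _ x Logic.I).
  by exists y.
- move=> _ /codomP[[i j] ->]; apply/negP => /mapP[g gfs].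
  have gI : (index g fs < m + 5)%N by rewrite -fs_size index_mem.
  have -> : g = f (Ordinal gI) by rewrite /f nth_index.
  exact: k_off.
(* Near [z], all points that must differ for the argument do differ. *)
pose kf (u : 'I_m * 'I_(m + 5)) := (k u.1 * f u.2)%g.
pose t2kf (u : 'I_m * 'I_(m + 5)) := (t2 * (k u.1 * f u.2))%g.
pose near_maps := fs ++ codom kf ++ codom t2kf.
have nm1 j : f j \in near_maps by rewrite mem_cat ffs.
have nm2 i j : (k i * f j)%g \in near_maps.
  by rewrite !mem_cat (codom_f kf (i, j)) ?orbT.
have nm3 i j : (t2 * (k i * f j))%g \in near_maps.
  by rewrite !mem_cat (codom_f t2kf (i, j)) ?orbT.
have nmF g : g \in near_maps -> full_group G g.
  rewrite mem_cat => /orP[/fsA/full//|].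
  rewrite mem_cat => /orP[/codomP[u ->]|/codomP[u ->]].
    by apply/full/generated_mul.
  by apply/full/generated_mul => //; exact: generated_mul.
have nO : nbhs z [set y | forall j, t2 (f j y) = f j y].
  apply: filter_forall => j.
  have fc : continuous (f j) by exact/full_group_continuous/full.
  by apply: (fc z [set y | t2 y = y]); exact: t2_id.
have [W [cW Wz WO Wsep]] := separate_near hX nmF nO.
exists W; split=> // V s cV VW sV.
have [[v Vv]|V0] := pselect (V !=set0); last first.
  suff -> : s = 1%g by [].
  apply: sym_ext => y; rewrite (sV.2 y) // => -[] Vy; apply: V0.
  - by exists y.
  - by exists ((c^-1)%g y).
  - by exists ((c^-1)%g ((c^-1)%g y)).
have disj i j y : V (((f i)^-1)%g y) -> V (((f j)^-1)%g y) -> i = j.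
  move=> Vi Vj; apply: contrapT => ij.
  apply: (Wsep (f i) (f j) (nm1 i) (nm1 j) _ _ _ (VW _ Vi) (VW _ Vj)).
    by apply/eqP => /f_inj.
  by rewrite !symKV.
have I5 : (4 < #|'I_(m + 5)|)%N by rewrite card_ord addnC.
have small : (2 * m`! < (#|'I_(m + 5)|)`!)%N.
  rewrite card_ord addnS factS addnS factS.
  apply: leq_trans (_ : 3 * m`! <= _)%N; first by rewrite ltn_pmul2r ?fact_gt0.
  apply: leq_mul; first by rewrite addnC.
  apply: (leq_trans (leq_fact (leq_addr 3 m))).
  by rewrite leq_pmull.
pose W1 : set X := [set y | exists i j v, V v /\ y = k i (f j v)].
pose W2 : set X := [set y | exists i j v, V v /\ y = t2 (k i (f j v))].
have copiesP y : copies f V y -> exists j v, V v /\ y = f j v.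
  by case=> j Vj; exists j, (((f j)^-1)%g y); rewrite symKV.
have d1 : copies f V `&` W1 = set0.
  apply/seteqP; split=> // y [/copiesP[l [v' [Vv' ->]]] [i [j [v'' [Vv'' e]]]]].
  apply: (Wsep _ _ (nm1 l) (nm2 i j) _ _ _ (VW _ Vv') (VW _ Vv'') e).
  by apply/eqP => /esym; exact: k_off.
have d2 : copies f V `&` W2 = set0.
  apply/seteqP; split=> // y [/copiesP[l [v' [Vv' ->]]] [i [j [v'' [Vv'' e]]]]].
  apply: (Wsep _ _ (nm1 l) (nm3 i j) _ _ _ (VW _ Vv') (VW _ Vv'') e).
  apply/eqP; rewrite !sym_mulE -(nbhs_singleton (t2_id _ (f_pts l))).
  by move/(can_inj (symVK t2))/esym; exact: k_off.
have d12 : W1 `&` W2 = set0.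
  apply/seteqP; split=> // y [[i [j [v' [Vv' ->]]]] [i' [j' [v'' [Vv'' e]]]]].
  apply: (Wsep _ _ (nm2 i j) (nm3 i' j') _ _ _ (VW _ Vv') (VW _ Vv'') e).
  apply/eqP => e'; apply: (t2_off _ (in_imgs i' j')) => /=.
  by rewrite -[t2 _]e'; exact: in_imgs.
have proj1 := confined_projection disj I5 fA cV (ex_intro _ v Vv) K1 KM KV
  (h := k) (W := W1) small.
have {proj1} proj1 : forall q, q \in ('Alt_('I_(m + 5)))%g ->
    exists2 r, supported W1 r & K (shuffle disj q * r)%g.
  apply: proj1 => //; first by move=> i j w Vw; exists i, j, w.
  exact: conjugate_confined.
have proj2 := confined_projection disj I5 fA cV (ex_intro _ v Vv) K1 KM KV
  (h := fun i => (t2 * k i * t2^-1)%g) (W := W2) small.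
have {proj2} proj2 : forall q, q \in ('Alt_('I_(m + 5)))%g ->
    exists2 r, supported W2 r & K (shuffle disj q * r)%g.
  apply: proj2 => //.
    move=> i j w Vw; exists i, j, w; split=> //; rewrite !sym_mulE.
    by rewrite -{1}(WO w (VW _ Vw) j) symVK.
  move=> g Ag; have [|i Ki] := @conjugate_confined (t * t2^-1)%g _ g Ag.
    by apply: generated_mul => //; exact: generated_inv.
  by exists i; move: Ki; rewrite /k invMg invgK !mulgA.
have altK := alternating_of_projections I5 K1 KM KV d1 d2 d12 proj1 proj2.
have lt5 a : (a < 3)%N -> (a < m + 5)%N.
  by move=> a3; apply: (leq_trans a3); rewrite (leq_trans (_ : 3 <= 5)%N) ?leq_addl.
pose i0 := Ordinal (lt5 0%N isT); pose i1 := Ordinal (lt5 1%N isT).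
pose i2 := Ordinal (lt5 2%N isT).
have u012 : uniq [:: i0; i2; i1] by [].
rewrite (restricts_ext sV (shuffle_restricts disj c3 _ _ _ u012)) //.
by apply: altK; rewrite Alt_even odd_permM !odd_tperm.
Qed.

(** The clopen sets over which the 3-cycle restricts into [K] include small
    neighbourhoods of all points; the restriction over a union of two of them is a
    product of restrictions over disjoint pieces. *)
Lemma confined_contains_three_cycles c : three_cycle G c -> K c.
Proof.
move=> cyc; have Ac : A c by exact: generated_mem.
have [_ c3 _ [U1 [U2 [U3 [[cU1 cU2 cU3] [d12 d13 d23] [im1 im2 im3] out]]]]] := cyc.
have cU y : U1 y -> U2 (c y) /\ U3 (c (c y)).
  move=> Uy; have Ucy : U2 (c y) by rewrite -im1; exists y.
  by split=> //; rewrite -im2; exists (c y).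
have disj2 (U V : set X) y : U `&` V = set0 -> U y -> V y -> False.
  by move=> UV Uy Vy; suff : (U `&` V) y by rewrite UV.
pose Q W := clopen W /\ forall V s, clopen V -> V `<=` W -> V `<=` U1 ->
  restricts c V s -> K s.
have [||||W U1W [_ QW]] := @compact_cover_ind X U1 Q.
- apply: subclosed_compact (cantor_compact hX) _ => //; by case: cU1.
- split; first exact: clopen0.
  move=> V s _ V0 _ [_ sV]; suff -> : s = 1%g by [].
  by apply: sym_ext => y; rewrite sV // => -[/V0|/V0|/V0].
- move=> W W' [cW QW] [cW' QW']; split; first exact: clopenU.
  move=> V s cV VWW' VU1 sV; have [s1 s1V] := exists_restriction c3 (V `&` W).
  have Ks1 : K s1.
    by apply: QW s1V; [exact: clopenI | move=> ? [] | move=> ? [/VU1]].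
  have -> : s = (s1 * (s1^-1 * s))%g by rewrite mulVKg.
  apply: (KM Ks1).
  apply: (QW' (V `&` ~` W)); first by apply: clopenI => //; exact: clopenC.
  + by move=> y [/VWW'[]].
  + by move=> y [/VU1].
  have spread_sub (V1 V2 : set X) y : V1 `<=` V2 -> spread c V1 y -> spread c V2 y.
    by move=> V12 [] /V12 ?; [constructor 1|constructor 2|constructor 3].
  have inU y V1 : V1 `<=` U1 -> spread c V1 y ->
      [\/ U1 y /\ V1 y, U2 y /\ V1 ((c^-1)%g y) | U3 y /\ V1 ((c^-1)%g ((c^-1)%g y))].
    move=> V1U [] Vy; first by constructor 1; split => //; exact: V1U.
      constructor 2; split => //.
      by have [+ _] := cU _ (V1U _ Vy); rewrite symKV.
    constructor 3; split => //.
    by have [_ +] := cU _ (V1U _ Vy); rewrite !symKV.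
  have sdisj y : spread c (V `&` W) y -> ~ spread c (V `&` ~` W) y.
    move=> /inU - /(_ (fun y Vy => VU1 y Vy.1)) S1.
    move=> /inU - /(_ (fun y Vy => VU1 y Vy.1)) S2.
    case: S1 => -[Uy [_ Wy]]; case: S2 => -[Uy' [_ Wy']]; try exact: Wy'.
    - exact: disj2 d12 Uy Uy'.
    - exact: disj2 d13 Uy Uy'.
    - exact: disj2 d12 Uy' Uy.
    - exact: disj2 d23 Uy Uy'.
    - exact: disj2 d13 Uy' Uy.
    - exact: disj2 d23 Uy' Uy.
  have scover y : spread c V y -> spread c (V `&` W) y \/ spread c (V `&` ~` W) y.
    case=> Vy; [have [Wy|nW] := pselect (W y)
      |have [Wy|nW] := pselect (W ((c^-1)%g y))
      |have [Wy|nW] := pselect (W ((c^-1)%g ((c^-1)%g y)))];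
      by [left; constructor 1|right; constructor 1|left; constructor 2
         |right; constructor 2|left; constructor 3|right; constructor 3].
  split=> y; rewrite sym_mulE => Sy.
    rewrite (sV.1 y); last by apply: spread_sub Sy => ? [].
    apply: (can_inj (symVK s1)); rewrite symKV s1V.2 // => /sdisj; apply.
    exact/spread_stable.
  have [S1|nS1] := pselect (spread c (V `&` W) y).
    rewrite (sV.1 y); last by apply: spread_sub S1 => ? [].
    by rewrite -(s1V.1 y) // symVK.
  rewrite (sV.2 y); last by move/scover => [].
  by apply: (can_inj (symVK s1)); rewrite symKV s1V.2.
- move=> z Uz; have [Uc Ucc] := cU z Uz.
  have [|W [cW Wz WK]] :=
    confined_contains_small_cycles Ac c3 (z := z).
    rewrite /= !inE negb_or andbT; apply/andP; split; first (apply/andP; split).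
    + by apply/eqP => e; apply: disj2 d12 Uz _; rewrite e.
    + by apply/eqP => e; apply: disj2 d13 Uz _; rewrite e.
    + by apply/eqP => e; apply: disj2 d23 Uc _; rewrite e.
  exists W; split=> //; first by case: cW.
  by split=> // V s cV VW _; exact: WK.
apply: (QW U1) => //; split=> // y nS; apply: out => Uy; apply: nS.
case: Uy => [[Uy|]|]; first by constructor 1.
  by rewrite -im1 => -[u Uu <-]; constructor 2; rewrite symVK.
rewrite -im2 -im1 => -[_ [u Uu <-] <-].
by constructor 3; rewrite !symVK.
Qed.

End ConfinedTheorem.

(** * Moving a point by finitely many elements simultaneously *)

Section SimultaneousMoves.
Variables (X : topologicalType) (G : germ_groupoid X).
Hypotheses (hX : cantor_set_homeomorphic X) (hmin : minimal_groupoid G).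
Local Notation A := (Defs.generated (three_cycle G)).
Local Notation AG := (alternating_full_group G).

Lemma alternating_lift g : A g -> exists a : AG, a = g :> sym X.
Proof.
move=> Ag; have gA : g \in alternating_pred G by exact/asboolP.
by exists (AlternatingFullGroup gA).
Qed.

Lemma alternating_mem (a : AG) : A a.
Proof. by case: a => g /= /asboolP. Qed.

(** Otherwise every point is fixed by some element of [hs].  Applied to all
    translates of a point, this says that its stabilizer is confined by [hs];
    hence it contains the 3-cycles, which generate the group. *)
Lemma simultaneously_moved (V : Type) (act : AG -> sym V) (hs : seq AG) (x : X) :
  {morph act : a b / (a * b)%g} ->
  (forall h : AG, h \in hs -> h x <> x) ->
  (exists a v, act a v <> v) ->
  exists v, forall h, h \in hs -> act h v <> v.
Proof.
move=> actM hsx [a0 [v0 nontriv]]; apply: contrapT => none; apply: nontriv.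
have act1 : act 1%g = 1%g by apply: (@mulgI _ (act 1%g)); rewrite -actM !mulg1.
have actV a : act (a^-1)%g = ((act a)^-1)%g.
  by apply/esym/mulg1_eq; rewrite -actM mulgV act1.
pose K : set (sym X) := [set g | exists2 a : AG, a = g :> sym X & act a v0 = v0].
have K1 : K 1%g by exists 1%g => //; rewrite act1.
have KM s t : K s -> K t -> K (s * t)%g.
  move=> [a <- av] [b <- bv]; exists (a * b)%g => //.
  by rewrite actM sym_mulE bv.
have KV s : K s -> K (s^-1)%g.
  move=> [a <- av]; exists (a^-1)%g => //.
  by rewrite actV -{1}av symVK.
pose h (i : 'I_(size hs)) : sym X := tnth (in_tuple hs) i.
have hA i : A (h i) by exact: alternating_mem.
have hx i : h i x <> x by apply: hsx; exact: mem_tnth.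
have conf g : A g -> exists i, K (g^-1 * h i * g)%g.
  move=> Ag; have [a ag] := alternating_lift Ag.
  have [b bhs bv] : exists2 b, b \in hs & act b (act a v0) = act a v0.
    apply: contrapT => nb; apply: none; exists (act a v0) => b bhs bv.
    by apply: nb; exists b.
  have /tnthP[i bi] : b \in in_tuple hs by [].
  exists i, (a^-1 * b * a)%g; first by rewrite -ag /h -bi.
  by rewrite !actM !sym_mulE bv actV symVK.
have AK g : A g -> K g.
  elim=> [c cyc||s t _ Ks _ Kt|s _ Ks] //.
  - exact: (confined_contains_three_cycles hX hmin K1 KM KV hA hx conf cyc).
  - exact: KM.
  - exact: KV.
have [a ea av] := AK a0 (alternating_mem a0).
by rewrite -(val_inj ea : a = a0).
Qed.

End SimultaneousMoves.

(** * Balls and walks *)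

Lemma nat_supremum_le (S : set nat) k :
  (forall a, S a -> (a <= k)%N) -> (supremum 0%N S <= k)%N.
Proof.
move=> Sk; rewrite /supremum; case: ifPn => // /set0P[a Sa].
case: xgetP => [b _ [_ bmin]|//].
exact: (bmin k) Sk.
Qed.

Lemma le_nat_supremum (S : set nat) k a :
  (forall b, S b -> (b <= k)%N) -> S a -> (a <= supremum 0%N S)%N.
Proof.
move=> Sk Sa; rewrite -leEnat; apply: ge_supremum_Nmem Sa.
by apply: nat_supremums_neq0; exists k => b /Sk.
Qed.

Lemma finite_uniform_bound (I : choiceType) (S : set I) (Q : I -> nat -> Prop) :
  finite_set S -> (forall i m n, (m <= n)%N -> Q i m -> Q i n) ->
  (forall i, S i -> exists n, Q i n) -> exists n, forall i, S i -> Q i n.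
Proof.
move=> /finite_seqP[s ->] Qmono Qs.
elim: s Qs => [|i s IH] Qs; first by exists 0%N.
have [n Qn] : exists n, forall j, [set` s] j -> Q j n.
  by apply: IH => j js; apply: Qs; rewrite /= inE [j \in s]js orbT.
have [n' Qn'] := Qs i (mem_head _ _).
exists (maxn n n') => j /=; rewrite inE => /predU1P[->|js].
  by apply: Qmono Qn'; exact: leq_maxr.
by apply: Qmono (Qn j js); exact: leq_maxl.
Qed.

Lemma card_fset_set_inj (I J : choiceType) (B : set I) (C : set J) (f : I -> J) :
  finite_set B -> finite_set C -> (forall i, B i -> C (f i)) ->
  (forall i j, B i -> B j -> f i = f j -> i = j) ->
  (#|` fset_set B| <= #|` fset_set C|)%N.
Proof.
move=> fB fC BC finj.
have memB i : i \in fset_set B -> B i by rewrite in_fset_set // => /set_mem.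
rewrite -(size_map f (fset_set B)); apply: uniq_leq_size.
  rewrite map_inj_in_uniq ?fset_uniq // => i j iB jB.
  by apply: finj; exact: memB.
by move=> _ /mapP[i iB ->]; rewrite in_fset_set //; apply/mem_set/BC/memB.
Qed.

Section Walks.
Variables (X : topologicalType) (T : set (partial_map X)).

(** The orbital graphs of all points are the components of this one graph on
    [X]; its balls are those of the orbital graphs. *)
Definition arrow (u v : X) : Prop := exists2 F, T F & F u v.

Definition walk_ball (x : X) (n : nat) : set X :=
  [set y | exists2 k, (k <= n)%N & walk arrow k x y].

Definition ball_card (x : X) (n : nat) : nat := #|` fset_set (walk_ball x n)|.

Hypothesis finT : finite_set T.
Hypothesis homeoT : forall F, T F -> partial_homeo F.

Lemma walk_ball_mono x m n : (m <= n)%N -> walk_ball x m `<=` walk_ball x n.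
Proof. by move=> mn y [k km xy]; exists k => //; exact: leq_trans mn. Qed.

Lemma walk_ball_center x n : walk_ball x n x.
Proof. by exists 0%N. Qed.

Lemma walk_ball_step x n u v :
  arrow u v \/ arrow v u -> walk_ball x n u -> walk_ball x n.+1 v.
Proof.
move=> uv [k kn xu]; exists (k + 1)%N; first by rewrite addn1.
by apply: walk_cat xu _; exists v.
Qed.

(** One step along a partial bijection of [T] or its inverse has at most one
    outcome, so the balls grow at most exponentially. *)
Lemma neighbours_listed :
  exists ls : seq (X -> X), forall u v, arrow u v \/ arrow v u ->
    exists2 f, f \in ls & v = f u.
Proof.
have /finite_seqP[s sE] := finT.
pose fwd F u := xget u [set v | F u v] : X.
pose bwd F u := xget u [set v | F v u] : X.
exists (map fwd s ++ map bwd s).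
move=> u v uv; have [F [TF Fuv]] : exists F, T F /\ (F u v \/ F v u).
  by case: uv => -[F TF Fuv]; exists F; split=> //; [left|right].
have [Ff Fi _ _] := homeoT TF.
have Fs : F \in s by move: TF; rewrite sE.
case: Fuv => Fuv.
  exists (fwd F); first by rewrite mem_cat map_f.
  by rewrite /fwd; case: xgetP => [w _ Fw|/(_ v)//]; exact: Ff Fuv Fw.
exists (bwd F); first by rewrite mem_cat [_ \in map bwd s]map_f ?orbT.
by rewrite /bwd; case: xgetP => [w _ Fw|/(_ v)//]; exact: Fi Fuv Fw.
Qed.

Fixpoint reach (ls : seq (X -> X)) (n : nat) (x : X) : seq X :=
  if n is m.+1 then flatten [seq reach ls m (f x) | f : X -> X <- ls] else [:: x].

Lemma size_reach ls n x : size (reach ls n x) = (size ls ^ n)%N.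
Proof.
elim: n x => [//|n IH] x /=; rewrite expnS.
by elim: {2 3}ls => [|f ls' IHl] //=; rewrite size_cat IH IHl mulSn.
Qed.

Lemma walk_ball_exponential :
  exists2 B, (0 < B)%N & forall x n,
    finite_set (walk_ball x n) /\ (ball_card x n <= B ^ n)%N.
Proof.
have [ls lsP] := neighbours_listed.
exists (size (id :: ls)) => // x n.
have sub : walk_ball x n `<=` [set` reach (id :: ls) n x].
  elim: n x => [|n IH] x y [k kn xy].
    by move: kn xy; rewrite leqn0 => /eqP-> /= ->; rewrite inE.
  have inreach f z : f \in id :: ls -> z \in reach (id :: ls) n (f x) ->
      z \in reach (id :: ls) n.+1 x.
    by move=> fl zr; apply/flattenP; exists (reach (id :: ls) n (f x)) => //;
      exact: (map_f (fun g : X -> X => reach (id :: ls) n (g x))).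
  case: k kn xy => [_ /= <-|k kn [w xw wy]].
    by apply: (inreach id); [exact: mem_head | apply: IH; exact: walk_ball_center].
  have [f fl wf] := lsP _ _ xw.
  apply: (inreach f); first by rewrite inE fl orbT.
  by apply: IH; exists k; rewrite // -wf.
have fin : finite_set (walk_ball x n) by apply: sub_finite_set sub _; exact: finite_seq.
split=> //; rewrite -(size_reach (id :: ls) n x).
have -> : ball_card x n = size (fset_set (walk_ball x n)) by [].
apply: uniq_leq_size; first exact: fset_uniq.
by move=> y; rewrite in_fset_set // => /set_mem /sub.
Qed.

Lemma walk_ball_finite x n : finite_set (walk_ball x n).
Proof. by have [B _ /(_ x n)[]] := walk_ball_exponential. Qed.

(** A ball that stops growing is a whole connected component, which the
    hypothesis excludes. *)
Lemma ball_card_ge x n :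
  (forall N, ~ (forall y k, walk arrow k x y -> walk_ball x N y)) ->
  (n < ball_card x n)%N.
Proof.
move=> inf; elim: n => [|n IH].
  rewrite /ball_card cardfs_gt0; apply/fset0Pn; exists x.
  by rewrite in_fset_set ?inE; [exact: walk_ball_center | exact: walk_ball_finite].
apply: leq_ltn_trans IH _; rewrite /ball_card.
apply: fproper_ltn_card; rewrite fproperE; apply/andP; split.
  rewrite -fset_set_sub; [exact: walk_ball_mono | exact: walk_ball_finite..].
apply/negP; rewrite -fset_set_sub; [|exact: walk_ball_finite..] => sub.
apply: (inf n) => y k.
have : walk_ball x n x by exact: walk_ball_center.
elim: k {2 3}x => [u|k IHk u] xu /=; first by move=> <-.
by move=> [w uw wy]; apply: IHk wy; apply: sub; exact: walk_ball_step uw xu.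
Qed.

End Walks.

(** * Orbital growth *)

Lemma near_all_seq (X : topologicalType) (I : eqType) (s : seq I) (y : X)
    (Q : I -> X -> Prop) :
  (forall i, i \in s -> \forall z \near y, Q i z) ->
  \forall z \near y, forall i, i \in s -> Q i z.
Proof.
elim: s => [_|i s IH Qs]; first by apply: nearW => z i; rewrite in_nil.
have Qi := Qs i (mem_head _ _).
have {}IH : \forall z \near y, forall j, j \in s -> Q j z.
  by apply: IH => j js; apply: Qs; rewrite inE js orbT.
by apply: filterS2 Qi IH => z Qi Qs' j; rewrite inE => /predU1P[->|/Qs'].
Qed.

Section Generators.
Variables (X : topologicalType) (G : germ_groupoid X).
Hypotheses (hX : cantor_set_homeomorphic X) (hmin : minimal_groupoid G).
Let PP := groupoid_pseudogroupP G.
Local Notation A := (Defs.generated (three_cycle G)).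

Section OneGeneratingSet.
Variable T : set (partial_map X).
Hypothesis hT : compact_generating G T.

Lemma generating_finite : finite_set T. Proof. by case: hT. Qed.

Lemma generating_groupoid F : T F -> groupoid_pseudogroup G F.
Proof. by case: hT => _ TG _ _; exact: TG. Qed.

Lemma generating_homeo F : T F -> partial_homeo F.
Proof. by move=> /generating_groupoid; exact: pseudogroup_homeo. Qed.

Lemma word_walk s y z : (forall F, F \in s -> T F \/ T (pm_inv F)) ->
  pm_word s y z -> walk (arrow T) (size s) y z.
Proof.
move=> sT yz; apply: walk_sym; elim: s z sT yz => [|F s IH] z sT /=.
  by case.
case=> c yc cz; have /= TF := sT F (mem_head _ _).
exists c; last by apply: IH => // H Hs; apply: sT; rewrite inE Hs orbT.
by case: TF => TF; [right; exists F|left; exists (pm_inv F)].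
Qed.

(** Near each point an element of the pseudogroup is a word in the generators,
    and compactness bounds the length of the words. *)
Lemma uniform_walks F (K : set X) : groupoid_pseudogroup G F ->
  compact K -> K `<=` pm_dom F ->
  exists N, forall x y, K x -> F x y -> walk_ball T x N y.
Proof.
move=> PF cK KF; have [hF gF] := PF.
pose Q U := exists N, forall x y, U x -> F x y -> walk_ball T x N y.
have [|||W KW [N WN]] := @compact_cover_ind X K Q cK.
- by exists 0%N.
- move=> U U' [N UN] [N' UN']; exists (maxn N N') => x y [Ux|Ux] Fxy.
    by apply: walk_ball_mono (UN _ _ Ux Fxy); exact: leq_maxl.
  by apply: walk_ball_mono (UN' _ _ Ux Fxy); exact: leq_maxr.
- move=> x /KF Fx; have [_ _ _ gen] := hT.
  have [s [x' [sT _ e]]] := gen _ (gF x Fx).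
  have := germ_mem x hF; rewrite e => -[_ /= xx' +]; subst x'.
  rewrite /prop_near1 nbhsE => -[U [oU Ux] Us].
  exists U; split => //; exists (size s) => y z Uy Fyz.
  by exists (size s) => //; apply: word_walk => //; rewrite -(Us y Uy).
by exists N => x y /KW; exact: WN.
Qed.

Lemma orbit_walk x y : groupoid_orbit G x y -> exists k, walk (arrow T) k x y.
Proof.
case=> F PF Fxy; have [|N FN] := uniform_walks PF (@compact_set1 X x).
  by move=> _ ->; exists y.
by have [k _ xy] := FN x y erefl Fxy; exists k.
Qed.

Lemma orbit_arrow x u v : groupoid_orbit G x u -> arrow T u v \/ arrow T v u ->
  groupoid_orbit G x v.
Proof.
case=> F PF Fxu [[H TH Huv]|[H TH Hvu]].
  exists (pm_comp H F); last by exists u.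
  by apply: (pseudogroup_comp PP) => //; exact: generating_groupoid.
exists (pm_comp (pm_inv H) F); last by exists u.
apply: (pseudogroup_comp PP) => //; apply: (pseudogroup_inv PP).
exact: generating_groupoid.
Qed.

Lemma walk_orbit x u v k : groupoid_orbit G x u -> walk (arrow T) k u v ->
  groupoid_orbit G x v.
Proof.
elim: k u => [u xu /= <-//|k IH u xu [w uw wv]].
by apply: IH wv; exact: orbit_arrow xu uw.
Qed.

Lemma ball_card_gt x n : (n < ball_card T x n)%N.
Proof.
apply: (ball_card_ge generating_finite generating_homeo) => N allN.
have fin := walk_ball_finite generating_finite generating_homeo x N.
have [F [y [PF Fxy _]]] :=
  orbit_avoid hX hmin x (fset_set (walk_ball T x N)) openT (ex_intro _ x Logic.I).
have [k xy] : exists k, walk (arrow T) k x y by apply: orbit_walk; exists F.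
by move/negP; apply; rewrite in_fset_set //; apply/mem_set/(allN y k).
Qed.

(** The germs of the successive arrows extend to elements of the alternating
    full group, so the walk survives a small perturbation of its start. *)
Lemma walk_persists k y w : walk (arrow T) k y w ->
  exists t, [/\ A t, t y = w & \forall z \near y, walk (arrow T) k z (t z)].
Proof.
elim: k y => [|k IH] y /=.
  move=> ->; exists 1%g; split => //; first exact: generated_one.
  exact: nearW.
case=> u yu uw; have [t [At tu tw]] := IH u uw.
have [s [As su sw]] : exists s, [/\ A s, s y = u &
    \forall z \near y, arrow T z (s z) \/ arrow T (s z) z].
  case: yu => -[F TF Fyu].
    have PF := generating_groupoid TF.
    have [s As sF] := germ_extends_alternating hX hmin PF Fyu.
    have [Ff _ _ _] := pseudogroup_homeo PP PF.
    exists s; split=> //; first exact: Ff (nbhs_singleton sF) Fyu.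
    by apply: filterS sF => z Fz; left; exists F.
  have PF := pseudogroup_inv PP (generating_groupoid TF).
  have [s As sF] := germ_extends_alternating hX hmin PF (Fyu : pm_inv F y u).
  have [Ff _ _ _] := pseudogroup_homeo PP PF.
  exists s; split=> //; first exact: Ff (nbhs_singleton sF) Fyu.
  by apply: filterS sF => z Fz; right; exists F.
exists (t * s)%g; split; first exact: generated_mul.
  by rewrite sym_mulE su.
have cs : continuous s by exact/full_group_continuous/alternating_full/As.
have tw' : \forall z \near y, walk (arrow T) k (s z) (t (s z)).
  by apply: (cs y [set u | walk (arrow T) k u (t u)]); rewrite su.
by apply: filterS2 sw tw' => z szz szw; exists (s z).
Qed.

(** The walks of a finite ball persist near its center, with distinct end
    points, and the orbit of [x] comes near the center.  Therefore all orbital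
    graphs have the same growth. *)
Lemma ball_card_dense x y n :
  exists2 z, groupoid_orbit G x z & (ball_card T y n <= ball_card T z n)%N.
Proof.
have fin z := walk_ball_finite generating_finite generating_homeo z n.
have tP w : exists t, walk_ball T y n w ->
    [/\ A t, t y = w & \forall z \near y, walk_ball T z n (t z)].
  have [[k kn yw]|nw] := pselect (walk_ball T y n w); last by exists 1%g.
  have [t [At ty tw]] := walk_persists yw.
  by exists t => _; split=> //; apply: filterS tw => z zw; exists k.
have /choice[t {}tP] := tP.
pose ws : seq X := fset_set (walk_ball T y n).
have wsP w : w \in ws -> walk_ball T y n w by rewrite in_fset_set // => /set_mem.
have near_walk : \forall z \near y, forall w, w \in ws -> walk_ball T z n (t w z).
  by apply: near_all_seq => w /wsP/tP[].
have tF s : s \in map t ws -> full_group G s.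
  by case/mapP => w /wsP/tP[At _ _] ->; exact: alternating_full At.
have [V [cV Vy VO Vsep]] := separate_near hX tF near_walk.
have [z [Vz xz]] : V `&` groupoid_orbit G x !=set0.
  by apply: hmin; [exists y | case: cV].
exists z => //; apply: (@card_fset_set_inj _ _ _ _ (fun w => t w z)) => //.
  by move=> w yw; apply: (VO _ Vz); rewrite in_fset_set //; exact/mem_set.
move=> w w' yw yw' e; apply: contrapT => /eqP ww'.
have ws_w : w \in ws by rewrite in_fset_set //; exact/mem_set.
have ws_w' : w' \in ws by rewrite in_fset_set //; exact/mem_set.
apply: (Vsep (t w) (t w') _ _ _ z z Vz Vz e); rewrite ?map_f //.
by have [_ -> _] := tP w yw; have [_ -> _] := tP w' yw'.
Qed.

Lemma ball_card_exponential :
  exists2 B, (0 < B)%N & forall x n, (ball_card T x n <= B ^ n)%N.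
Proof.
have [B B0 BP] := walk_ball_exponential generating_finite generating_homeo.
by exists B => // x n; have [] := BP x n.
Qed.

Variable R : realType.

Lemma walk_orbital x (y z : set_type (groupoid_orbit G x)) n :
  walk (orbital_edge T (x := x)) n y z <-> walk (arrow T) n (val y) (val z).
Proof.
elim: n y => [|n IH] y /=; first by split=> [->//|/val_inj].
split=> [[w yw /IH wz]|[w yw wz]]; first by exists (val w).
have xy : groupoid_orbit G x (val y) by exact: set_mem (valP y).
have /mem_set xw := orbit_arrow xy yw.
exists (exist _ w xw : set_type (groupoid_orbit G x)) => //.
exact/IH.
Qed.

Lemma orbital_ballE x (y : orbital_graph x R hT) n :
  cball y n = [set z | walk_ball T (val y) n (val z)].
Proof.
have conn := @orbital_connected X G T x hT.
apply/seteqP; split=> z; rewrite /cball /= ler_nat.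
  move=> yz; exists (graph_dist (orbital_edge T (x := x)) y z) => //.
  by apply/walk_orbital; have [] := graph_distP conn y z.
case=> k kn /walk_orbital yz; apply: leq_trans kn.
by have [_] := graph_distP conn y z; apply.
Qed.

Lemma orbital_ball_finite x (y : orbital_graph x R hT) n : finite_set (cball y n).
Proof.
rewrite orbital_ballE.
have fin := walk_ball_finite generating_finite generating_homeo (val y) n.
apply: (@finite_preimage _ _ (walk_ball T (val y) n) val _ fin).
by move=> ? ? _ _ /val_inj.
Qed.

Lemma orbital_ball_card x (y : orbital_graph x R hT) n :
  #|` fset_set (cball y n)| = ball_card T (val y) n.
Proof.
have fin := walk_ball_finite generating_finite generating_homeo (val y) n.
apply/eqP; rewrite eqn_leq; apply/andP; split.
  apply: (@card_fset_set_inj _ _ _ _ val) => //.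
  - exact: orbital_ball_finite.
  - by move=> z; rewrite orbital_ballE.
  - by move=> z z' _ _ /val_inj.
have xy : groupoid_orbit G x (val y) by exact: set_mem (valP y).
have lift z : exists z' : orbital_graph x R hT, walk_ball T (val y) n z -> val z' = z.
  have [[k _ yz]|nz] := pselect (walk_ball T (val y) n z); last by exists y.
  by exists (exist _ z (mem_set (walk_orbit xy yz)) : set_type (groupoid_orbit G x)).
have /choice[f fP] := lift.
apply: (@card_fset_set_inj _ _ _ _ f) => //; first exact: orbital_ball_finite.
  by move=> z yz; rewrite orbital_ballE /= fP.
by move=> z z' yz yz' e; rewrite -(fP z yz) -(fP z' yz') e.
Qed.

Lemma orbital_bounded_geometry x : bounded_geometry (orbital_graph x R hT).
Proof.
have [B B0 BP] := ball_card_exponential.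
move=> n; exists (B ^ n)%N => y; split; first exact: orbital_ball_finite.
by rewrite orbital_ball_card.
Qed.

Lemma growth_orbital_graph_le x n k : (forall y, ball_card T y n <= k)%N ->
  (growth (orbital_graph x R hT) n <= k)%N.
Proof.
by move=> le_k; apply: nat_supremum_le => _ [y _ <-]; rewrite orbital_ball_card.
Qed.

Lemma ball_card_le_growth x y n :
  (ball_card T y n <= growth (orbital_graph x R hT) n)%N.
Proof.
have [z xz /leq_trans] := ball_card_dense x y n; apply.
have [B B0 BP] := ball_card_exponential.
apply: (@le_nat_supremum _ (B ^ n)%N).
  by move=> _ [w _ <-]; rewrite orbital_ball_card.
exists (exist _ z (mem_set xz) : set_type (groupoid_orbit G x)) => //.
exact: (@orbital_ball_card x (exist _ z (mem_set xz) : set_type (groupoid_orbit G x))).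
Qed.

Lemma orbital_growth_le n k : (forall y, ball_card T y n <= k)%N ->
  (orbital_growth R hT n <= k)%N.
Proof.
by move=> le_k; apply: nat_supremum_le => _ [x _ <-]; exact: growth_orbital_graph_le.
Qed.

Lemma ball_card_le_orbital_growth y n : (ball_card T y n <= orbital_growth R hT n)%N.
Proof.
apply: leq_trans (ball_card_le_growth y y n) _.
have [B B0 BP] := ball_card_exponential.
apply: (@le_nat_supremum _ (B ^ n)%N); last by exists y.
by move=> _ [w _ <-]; exact: growth_orbital_graph_le.
Qed.

End OneGeneratingSet.

(** By compactness each generator in [T'] is, at each point, a word of bounded
    length in [T]. *)
Lemma ball_card_change T T' : compact_generating G T -> compact_generating G T' ->
  exists2 L, (0 < L)%N &
    forall x n, (ball_card T' x n <= ball_card T x (L * n))%N.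
Proof.
move=> hT hT'.
have [N NP] : exists N, forall F, T' F -> forall x y, F x y -> walk_ball T x N y.
  apply: (@finite_uniform_bound _ T' (fun F N => forall x y, F x y -> walk_ball T x N y)).
  - exact: generating_finite hT'.
  - by move=> F m n mn Fm x y Fxy; apply: walk_ball_mono mn _ _; exact: Fm.
  move=> F TF; have [_ _ /(_ F TF)[cF _] _] := hT'.
  have cptF : compact (pm_dom F).
    by apply: subclosed_compact (cantor_compact hX) _ => //; case: cF.
  have [N FN] := uniform_walks hT (generating_groupoid hT' TF) cptF (fun=> id).
  by exists N => x y Fxy; apply: FN => //; exists y.
have step u v : arrow T' u v \/ arrow T' v u -> walk_ball T u N.+1 v.
  move=> [[F TF Fuv]|[F TF Fvu]].
    by have [k kN uv] := NP F TF u v Fuv; exists k => //; exact: leqW.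
  have [k kN vu] := NP F TF v u Fvu; exists k; first exact: leqW.
  exact: walk_sym.
exists N.+1 => // x n.
have fin := walk_ball_finite (generating_finite hT) (generating_homeo hT).
have fin' := walk_ball_finite (generating_finite hT') (generating_homeo hT').
apply: fsubset_leq_card; rewrite -fset_set_sub //.
move=> y [k kn]; elim: k n x kn => [|k IH] n x.
  by move=> _ /= ->; exact: walk_ball_center.
case: n => // n kn [w xw wy].
have [i iN xw'] := step _ _ xw; have [j jn wy'] := IH n w kn wy.
exists (i + j)%N; first by rewrite mulnS leq_add.
exact: walk_cat xw' wy'.
Qed.

End Generators.

(** * Actions by wobbling permutations *)

Section Actions.
Variables (X : topologicalType) (G : germ_groupoid X).
Hypotheses (hX : cantor_set_homeomorphic X) (hmin : minimal_groupoid G).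
Variable T : set (partial_map X).
Hypothesis hT : compact_generating G T.
Variable R : realType.
Local Notation AG := (alternating_full_group G).

(** Compactness of the domains makes finitely many of the elements that extend
    germs of generators sufficient. *)
Lemma generators_imitated : exists S : seq AG,
  forall u v, arrow T u v -> exists2 a : AG, a \in S & a u = v.
Proof.
pose imitated (F : partial_map X) (U : set X) (S : seq AG) :=
  forall u v, U u -> F u v -> exists2 a : AG, a \in S & a u = v.
have SP F : exists S, T F -> imitated F (pm_dom F) S.
  have [TF|nT] := pselect (T F); last by exists [::].
  have [_ _ /(_ F TF)[cF _] _] := hT.
  have cptF : compact (pm_dom F).
    by apply: subclosed_compact (cantor_compact hX) _ => //; case: cF.
  have PF := generating_groupoid hT TF.
  have [Ff _ _ _] := generating_homeo hT TF.
  have [|||W domW [S WS]] := @compact_cover_ind X (pm_dom F)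
    (fun U => exists S, imitated F U S) cptF.
  - by exists [::].
  - move=> U U' [S US] [S' US']; exists (S ++ S') => u v [Uu|Uu] Fuv.
      by have [a aS av] := US u v Uu Fuv; exists a; rewrite // mem_cat aS.
    by have [a aS av] := US' u v Uu Fuv; exists a; rewrite // mem_cat aS orbT.
  - move=> u [v Fuv]; have [t At tF] := germ_extends_alternating hX hmin PF Fuv.
    have [a at_] := alternating_lift At.
    move: tF; rewrite /prop_near1 nbhsE => -[U [oU Uu] UF].
    exists U; split=> //; exists [:: a] => w w' Uw Fww'.
    by exists a; rewrite ?mem_head // at_; exact: Ff (UF w Uw) Fww'.
  by exists S => _ u v /domW; exact: WS.
have /choice[S {}SP] := SP.
have /finite_seqP[ts tsE] := generating_finite hT.
exists (flatten [seq S F | F <- ts]) => u v [F TF Fuv].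
have [a aS av] := SP F TF u v (ex_intro _ v Fuv) Fuv.
exists a => //; apply/flattenP; exists (S F) => //; apply: (map_f S).
by move: TF; rewrite tsE.
Qed.

Section Wobbling.
Variables (V : metricType R) (act : AG -> wobbling V).
Hypothesis actM : {morph act : a b / (a * b)%g}.

Let act_symM : {morph (fun a => act a : sym V) : a b / (a * b)%g}.
Proof. by move=> a b; rewrite actM. Qed.

Lemma wobbling_displacement (w : wobbling V) :
  exists N : nat, forall v : V, (mdist v (w v) <= N%:R :> R)%R.
Proof.
case: w => s /= /asboolP[C sC]; exists (Num.bound `|C|%R) => v.
apply: le_trans (sC v) (le_trans (ler_norm _) (ltW _)).
exact: archi_boundP.
Qed.

(** The element is the product of the imitations of the successive arrows, each
    of which displaces points of [V] by at most [C]. *)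
Lemma walk_displacement : exists C : nat, forall n x y, walk (arrow T) n x y ->
  exists2 a : AG, a x = y & forall v : V, (mdist v (act a v) <= (C * n)%:R :> R)%R.
Proof.
have [S ST] := generators_imitated.
have [C CP] : exists C : nat, forall a : AG, [set` S] a ->
    forall v : V, (mdist v (act a v) <= C%:R :> R)%R.
  apply: (@finite_uniform_bound _ [set` S]
    (fun (a : AG) C => forall v : V, (mdist v (act a v) <= C%:R :> R)%R)).
  - exact: finite_seq.
  - by move=> a m n mn am v; apply: le_trans (am v) _; rewrite ler_nat.
  - by move=> a _; exact: wobbling_displacement.
have act1 : (act 1%g : sym V) = 1%g.
  by apply: (@mulgI _ (act 1%g : sym V)); rewrite -act_symM !mulg1.
have step u v : arrow T u v \/ arrow T v u -> exists2 a : AG, a u = v &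
    forall w : V, (mdist w (act a w) <= C%:R :> R)%R.
  move=> [/ST[a aS av]|/ST[a aS av]]; first by exists a => //; exact: CP.
  exists (a^-1)%g; first by rewrite -av; exact: (symVK (a : sym X)).
  move=> w; rewrite metric_sym; set w' := act (a^-1)%g w.
  have <- : act a w' = w.
    have := congr1 (fun s : sym V => s w) (act_symM a (a^-1)%g).
    by rewrite /= mulgV act1.
  exact: CP.
exists C; elim=> [|n IH] x y /=.
  move=> ->; exists 1%g => // v.
  by rewrite act1 mdistxx.
move=> [u xu /IH[a au aC]]; have [b bx bC] := step _ _ xu.
exists (a * b)%g; first by rewrite -au -bx.
move=> v; have -> : (act (a * b)%g : sym V) v = act a (act b v).
  by rewrite (act_symM a b).
apply: le_trans (metric_triangle _ (act b v) _) _.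
by rewrite mulnS natrD lerD.
Qed.

(** The elements [a w] that carry [x] to the points [w] of a ball have quotients
    that move [x]; a point of [V] moved by all these quotients has distinct images
    under the [a w]. *)
Lemma growth_of_nontrivial_action : bounded_geometry V ->
  (exists a v, act a v <> v) -> growth_le (orbital_growth R hT) (growth V).
Proof.
move=> bV nontriv; have [C CP] := walk_displacement.
exists C.+1 => // n; apply: orbital_growth_le => x.
have fin := walk_ball_finite (generating_finite hT) (generating_homeo hT) x n.
have lift w : exists a : AG, walk_ball T x n w -> a x = w /\
    forall v : V, (mdist v (act a v) <= (C * n)%:R :> R)%R.
  have [[k kn xw]|nw] := pselect (walk_ball T x n w); last by exists 1%g.
  have [a ax aC] := CP k x w xw.
  exists a => _; split => // v; apply: le_trans (aC v) _.
  by rewrite ler_nat leq_mul2l kn orbT.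
have /choice[a aP] := lift.
pose ws : seq X := fset_set (walk_ball T x n).
have wsE w : walk_ball T x n w -> w \in ws.
  by move=> xw; rewrite in_fset_set //; exact/mem_set.
pose hs := [seq h <- [seq ((a w)^-1 * a w')%g | w <- ws, w' <- ws]
  | `[< (h : AG) x <> x >]].
have [|v vP] := simultaneously_moved hX hmin (hs := hs) act_symM _ nontriv (x := x).
  by move=> h; rewrite mem_filter => /andP[/asboolP].
have [N NP] := bV (C.+1 * n)%N.
apply: (@leq_trans #|` fset_set (cball v (C.+1 * n))|); last first.
  apply: (@leq_trans (growth V (C.+1 * n))); last by rewrite leq_pmull.
  by apply: (@le_nat_supremum _ N); [move=> _ [u _ <-]; have [] := NP u | exists v].
apply: (@card_fset_set_inj _ _ _ _ (fun w => act (a w) v)) => //.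
- by have [] := NP v.
- move=> w xw; rewrite /cball /=; apply: le_trans ((aP w xw).2 v) _.
  by rewrite ler_nat leq_mul2r leqnSn orbT.
move=> w w' xw xw' e; apply: contrapT => ww'.
pose h := ((a w)^-1 * a w')%g.
have ah : (a w * h)%g = a w' by rewrite mulVKg.
have hx : h x <> x.
  move=> e'; apply: ww'; rewrite -(aP w xw).1 -(aP w' xw').1 -ah.
  by rewrite -[RHS]/(a w (h x)) e'.
have hhs : h \in hs.
  rewrite mem_filter; apply/andP; split; first exact/asboolP.
  by apply/allpairsP; exists (w, w'); split; rewrite ?wsE.
apply: (vP h hhs); apply: (can_inj (symVK (act (a w) : sym V))).
by rewrite e -ah (act_symM (a w) h).
Qed.

End Wobbling.

(** * The action on an orbit *)

Section OrbitAction.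
Variable x : X.
Local Notation orbit_space := (orbital_graph x R hT).
Implicit Types (a b : AG) (y : orbit_space).

Lemma orbit_stable a (z : X) : groupoid_orbit G x z -> groupoid_orbit G x (a z).
Proof.
case=> F PF Fxz; exists (pm_comp (fun u v => v = a u) F); last by exists z.
apply: (pseudogroup_comp (groupoid_pseudogroupP G)) PF.
exact: (alternating_full (alternating_mem a)).
Qed.

Definition orbit_fun a (y : set_type (groupoid_orbit G x)) :
    set_type (groupoid_orbit G x) :=
  exist _ (a (val y)) (mem_set (orbit_stable a (set_mem (valP y)))).

Lemma orbit_funK a : cancel (orbit_fun a) (orbit_fun (a^-1)%g).
Proof. by move=> y; apply: val_inj; exact: (symVK (a : sym X)). Qed.

Lemma orbit_funVK a : cancel (orbit_fun (a^-1)%g) (orbit_fun a).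
Proof. by move=> y; apply: val_inj; exact: (symKV (a : sym X)). Qed.

Definition orbit_perm a : sym orbit_space :=
  Defs.Sym (orbit_funK a : cancel (_ : orbit_space -> orbit_space) _) (orbit_funVK a).

Lemma orbit_perm_wobbling a : orbit_perm a \in wobbling_pred (V := orbit_space).
Proof.
apply/asboolP; have aF := alternating_full (alternating_mem a).
have [|N NP] := uniform_walks hT aF (cantor_compact hX).
  by move=> z _; exists (a z).
exists N%:R%R => y.
have : cball y N (orbit_perm a y) by rewrite orbital_ballE; exact: NP.
by [].
Qed.

Definition orbit_action a : wobbling orbit_space := Wobbling (orbit_perm_wobbling a).

Lemma orbit_actionM : {morph orbit_action : a b / (a * b)%g}.
Proof. by move=> a b; apply/val_inj/sym_ext => y; exact: val_inj. Qed.

HB.instance Definition _ :=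
  isMultiplicative.Build AG (wobbling orbit_space) orbit_action orbit_actionM.

Lemma orbit_action_inj : injective orbit_action.
Proof.
move=> a b ab; apply/val_inj/sym_ext => z; apply: contrapT => /eqP abz.
have fs_full s : s \in [:: a : sym X; b : sym X] -> full_group G s.
  by rewrite !inE => /orP[]/eqP->; exact: (alternating_full (alternating_mem _)).
have zT : nbhs z setT by exact: filterT.
have [V [[oV _] Vz _ Vsep]] := separate_near hX fs_full zT.
have [y [Vy xy]] : V `&` groupoid_orbit G x !=set0 by apply: hmin => //; exists z.
apply: (Vsep a b _ _ abz y y Vy Vy); rewrite ?inE ?eqxx ?orbT //.
pose y' : orbit_space := exist _ y (mem_set xy).
exact: (congr1 (fun s : wobbling orbit_space => val (s y')) ab).
Qed.

End OrbitAction.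

End Actions.

Theorem theorem1p14 (R : realType) (X : topologicalType)
  (hX : cantor_set_homeomorphic X) (G : germ_groupoid X)
  (hmin : minimal_groupoid G)
  (T : set (partial_map X)) (hT : compact_generating G T) :
  property_FG R (orbital_growth R hT) (alternating_full_group G) /\
  forall (T' : set (partial_map X)) (hT' : compact_generating G T') (x : X),
    [/\ bounded_geometry (orbital_graph x R hT'),
        growth_equiv (growth (orbital_graph x R hT')) (orbital_growth R hT) &
        exists phi : {multiplicative alternating_full_group G ->
                                     wobbling (orbital_graph x R hT')},
          injective phi].
Proof.
split.
  split.
  - exists 1%N => // n; rewrite !mul1n; have [x _] := cantor_nonempty hX.
    apply: leq_trans (ball_card_le_orbital_growth hX hmin hT R x n).
    exact/ltnW/ball_card_gt.
  - have [B B0 BP] := ball_card_exponential hT.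
    exists B => // n; apply: orbital_growth_le => y; apply: leq_trans (BP y n) _.
    apply: (@leq_trans (2 ^ (B * n))); last by rewrite leq_pmull.
    rewrite expnM; case: n => // n; rewrite leq_exp2r //.
    by apply/ltnW/ltn_expl.
  - move=> V bV slow phi.
    have [nontriv|triv] := pselect (exists a v, phi a v <> v).
      exfalso; apply: slow; apply: growth_of_nontrivial_action bV nontriv => //.
      exact: gmulfM.
    apply: (@sub_finite_set _ _ [set 1%g]); last exact: finite_set1.
    move=> _ [a _ <-]; apply/val_inj/sym_ext => v.
    by apply: contrapT => av; apply: triv; exists a, v.
move=> T' hT' x; split.
- exact: orbital_bounded_geometry.
- split.
    have [L L0 LP] := ball_card_change hX hT hT'.
    exists L => // n; apply: growth_orbital_graph_le => y.
    apply: leq_trans (LP y n) _.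
    apply: leq_trans (ball_card_le_orbital_growth hX hmin hT R y _) _.
    exact: leq_pmull.
  have [L L0 LP] := ball_card_change hX hT' hT.
  exists L => // n; apply: orbital_growth_le => y.
  apply: leq_trans (LP y n) _.
  apply: leq_trans (ball_card_le_growth hX hmin hT' R x y _) _.
  exact: leq_pmull.
- by exists (orbit_action hX hT' R x); exact: orbit_action_inj.
Qed.
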